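(* For every $\ell\ge5$, $$I_\ell^{\mathrm{cand}}\subset J_{2,\ell}.$$
   Context: $\mathfrak g=D_\ell=\mathfrak{so}_{2\ell}(\mathbb C)$; in orthonormal coordinates $\varepsilon_1,\dots,\varepsilon_\ell$ of $\mathfrak h^*$: $\alpha_i=\varepsilon_i-\varepsilon_{i+1}$ ($1\le i\le\ell-1$), $\alpha_\ell=\varepsilon_{\ell-1}+\varepsilon_\ell$. $L_{\mathfrak g}(\lambda)$ is the simple highest-weight $\mathfrak g$-module of highest weight $\lambda$, and $J_{2,\ell}:=\operatorname{Ann}_{U(\mathfrak g)}L_{\mathfrak g}(-\alpha_2)$. Put $r=\ell-2$. $V^{-1}(\mathfrak g)$ is the universal affine vertex algebra of level $-1$. Let $w_A,w_D\in S^2(\mathfrak g)$ be nonzero highest-weight vectors of weights $2\varepsilon_1$ and $\varepsilon_1+\varepsilon_2+\varepsilon_3+\varepsilon_4$ (each unique up to scalar; these are the highest vectors of the two Arakawa–Moreau summands), and $\sigma:S^2(\mathfrak g)\to V^{-1}(\mathfrak g)$, $\sigma(xy)=\tfrac12\big(x(-1)y(-1)+y(-1)x(-1)\big)\mathbf 1$. Put $s_A=\sigma(w_A)^r$, $s_D=\sigma(w_D)^2$, powers being taken in $U(t^{-1}\mathfrak g[t^{-1}])\cong V^{-1}(\mathfrak g)$ (the root-vector modes involved commute); these are singular vectors. Under the canonical identification of the Zhu algebra $A(V^{-1}(\mathfrak g))\cong U(\mathfrak g)$, $[x(-1)\mathbf 1]\mapsto x$, $I_\ell^{\mathrm{cand}}\subset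 U(\mathfrak g)$ is the two-sided ideal generated by the Zhu classes $[s_A],[s_D]$; equivalently, for $Q_\ell=V^{-1}(\mathfrak g)/\langle s_A,s_D\rangle$, $A(Q_\ell)\cong U(\mathfrak g)/I_\ell^{\mathrm{cand}}$. *)

(* Defs.v *)
From HB Require Import structures.
From mathcomp Require Import all_boot all_order all_algebra.
From mathcomp Require Import ring boolp.
From mathcomp Require Export reals.
From mathcomp Require Export complex.

Set Implicit Arguments.
Unset Strict Implicit.
Unset Printing Implicit Defensive.

Import GRing.Theory.
Local Open Scope ring_scope.
Local Open Scope quotient_scope.

Inductive term (F X : Type) : Type :=
| Gen of X
| Cst of F
| Add of term F X & term F X
| Mul of term F X & term F X.
Arguments Gen {F X}.
Arguments Cst {F X}.
Arguments Add {F X}.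
Arguments Mul {F X}.

HB.instance Definition _ (F X : Type) := gen_eqMixin (term F X).
HB.instance Definition _ (F X : Type) := gen_choiceMixin (term F X).

(* The least congruence containing [rel] whose quotient is an associative
   unital F-algebra with structure map [Cst]. *)
Inductive algebra_congr (F : fieldType) (X : Type)
    (rel : term F X -> term F X -> Prop) : term F X -> term F X -> Prop :=
| AC_rel s t : rel s t -> algebra_congr rel s t
| AC_refl t : algebra_congr rel t t
| AC_sym s t : algebra_congr rel s t -> algebra_congr rel t s
| AC_trans s t u :
    algebra_congr rel s t -> algebra_congr rel t u -> algebra_congr rel s u
| AC_add s s' t t' : algebra_congr rel s s' -> algebra_congr rel t t' ->
    algebra_congr rel (Add s t) (Add s' t')
| AC_mul s s' t t' : algebra_congr rel s s' -> algebra_congr rel t t' ->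
    algebra_congr rel (Mul s t) (Mul s' t')
| AC_addA s t u : algebra_congr rel (Add s (Add t u)) (Add (Add s t) u)
| AC_addC s t : algebra_congr rel (Add s t) (Add t s)
| AC_add0 t : algebra_congr rel (Add (Cst 0) t) t
| AC_mulA s t u : algebra_congr rel (Mul s (Mul t u)) (Mul (Mul s t) u)
| AC_mul0 t : algebra_congr rel (Mul (Cst 0) t) (Cst 0)
| AC_mul1 t : algebra_congr rel (Mul (Cst 1) t) t
| AC_mulDl s t u : algebra_congr rel (Mul (Add s t) u) (Add (Mul s u) (Mul t u))
| AC_mulDr s t u : algebra_congr rel (Mul u (Add s t)) (Add (Mul u s) (Mul u t))
| AC_cstD a b : algebra_congr rel (Cst (a + b)) (Add (Cst a) (Cst b))
| AC_cstM a b : algebra_congr rel (Cst (a * b)) (Mul (Cst a) (Cst b))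
| AC_cstC a t : algebra_congr rel (Mul (Cst a) t) (Mul t (Cst a)).

Section Presented.
Variables (F : fieldType) (X : Type) (rel : term F X -> term F X -> Prop).

Local Notation congr := (algebra_congr rel).

Definition congrb (s t : term F X) : bool := `[< congr s t >].

Lemma congrb_equiv : equiv_class_of congrb.
Proof.
split=> [t|s t|t s u].
- exact/asboolP/AC_refl.
- by apply/asboolP/asboolP; apply: AC_sym.
- by move=> /asboolP st /asboolP tu; apply/asboolP/(AC_trans st tu).
Qed.

Canonical congrb_equivRel := EquivRelPack congrb_equiv.
Canonical congrb_encModRel := defaultEncModRel congrb.

Definition presented := {eq_quot congrb}.
HB.instance Definition _ := Choice.on presented.
HB.instance Definition _ : EqQuotient _ congrb presented :=
  EqQuotient.on presented.

Definition pclass (t : term F X) : presented := \pi_presented t.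

Lemma pclassP s t : congr s t <-> pclass s = pclass t.
Proof.
split=> [st|/eqmodP/asboolP//].
exact/eqmodP/asboolP.
Qed.

Lemma pclass_repr x : pclass (repr x) = x.
Proof. exact: reprK. Qed.

Lemma repr_pclass t : congr (repr (pclass t)) t.
Proof. by apply/pclassP; rewrite pclass_repr. Qed.

Definition padd (x y : presented) := pclass (Add (repr x) (repr y)).
Definition pmul (x y : presented) := pclass (Mul (repr x) (repr y)).
Definition popp (x : presented) := pclass (Mul (Cst (-1)) (repr x)).
Definition pscale (a : F) (x : presented) := pclass (Mul (Cst a) (repr x)).

Lemma pclassD s t : padd (pclass s) (pclass t) = pclass (Add s t).
Proof. by apply/pclassP; apply: AC_add; apply: repr_pclass. Qed.
Lemma pclassM s t : pmul (pclass s) (pclass t) = pclass (Mul s t).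
Proof. by apply/pclassP; apply: AC_mul; apply: repr_pclass. Qed.
Lemma pclassZ_def a t : pscale a (pclass t) = pclass (Mul (Cst a) t).
Proof. by apply/pclassP; apply: AC_mul; [apply: AC_refl|apply: repr_pclass]. Qed.
Lemma pclassN_def t : popp (pclass t) = pclass (Mul (Cst (-1)) t).
Proof. exact: pclassZ_def. Qed.

Let E := (pclassD, pclassM, pclassZ_def, pclassN_def).
Let elim1 (P : presented -> Prop) : (forall t, P (pclass t)) -> forall x, P x.
Proof. by move=> h x; rewrite -[x]pclass_repr. Qed.

Fact paddA : associative padd.
Proof.
by move=> x y z; elim/elim1: x => x; elim/elim1: y => y; elim/elim1: z => z;
  rewrite !E; apply/pclassP/AC_addA.
Qed.
Fact paddC : commutative padd.
Proof.
by move=> x y; elim/elim1: x => x; elim/elim1: y => y;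
  rewrite !E; apply/pclassP/AC_addC.
Qed.
Fact padd0 : left_id (pclass (Cst 0)) padd.
Proof. by elim/elim1=> x; rewrite !E; apply/pclassP/AC_add0. Qed.

Lemma cst1K t : pclass t = pclass (Mul (Cst 1) t).
Proof. by apply/pclassP; apply: AC_sym; apply: AC_mul1. Qed.

Fact paddN : left_inverse (pclass (Cst 0)) popp padd.
Proof.
elim/elim1=> x; rewrite pclassN_def [pclass x]cst1K pclassD; apply/pclassP.
apply: AC_trans (AC_sym (AC_mulDl _ _ _ _)) _.
apply: AC_trans (AC_mul0 _ x); apply: AC_mul; last exact: AC_refl.
by have := AC_cstD rel (-1) 1; rewrite addNr; apply: AC_sym.
Qed.

HB.instance Definition _ :=
  GRing.isZmodule.Build presented paddA paddC padd0 paddN.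

Fact pmulA : associative pmul.
Proof.
by move=> x y z; elim/elim1: x => x; elim/elim1: y => y; elim/elim1: z => z;
  rewrite !E; apply/pclassP/AC_mulA.
Qed.
Fact pmul1 : left_id (pclass (Cst 1)) pmul.
Proof. by elim/elim1=> x; rewrite !E; apply/pclassP/AC_mul1. Qed.
Fact pmulr1 : right_id (pclass (Cst 1)) pmul.
Proof.
elim/elim1=> x; rewrite !E; apply/pclassP.
exact: AC_trans (AC_sym (AC_cstC _ _ _)) (AC_mul1 _ _).
Qed.
Fact pmulDl : left_distributive pmul +%R.
Proof.
move=> x y z; elim/elim1: x => x; elim/elim1: y => y; elim/elim1: z => z.
by rewrite /GRing.add /= !E; apply/pclassP/AC_mulDl.
Qed.
Fact pmulDr : right_distributive pmul +%R.
Proof.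
move=> x y z; elim/elim1: x => x; elim/elim1: y => y; elim/elim1: z => z.
by rewrite /GRing.add /= !E; apply/pclassP/AC_mulDr.
Qed.

HB.instance Definition _ :=
  GRing.Zmodule_isPzRing.Build presented pmulA pmul1 pmulr1 pmulDl pmulDr.

Fact pscaleA a b x : pscale a (pscale b x) = pscale (a * b) x.
Proof.
elim/elim1: x => x; rewrite !E; apply/pclassP.
apply: AC_trans (AC_mulA _ _ _ _) _.
by apply: AC_mul; [apply: AC_sym; apply: AC_cstM | apply: AC_refl].
Qed.
Fact pscale1 : left_id 1 pscale.
Proof. by elim/elim1=> x; rewrite !E; apply/pclassP/AC_mul1. Qed.
Fact pscaleDr : right_distributive pscale +%R.
Proof.
move=> a x y; elim/elim1: x => x; elim/elim1: y => y.
by rewrite /GRing.add /= !E; apply/pclassP/AC_mulDr.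
Qed.
Fact pscaleDl x : {morph pscale^~ x : a b / a + b}.
Proof.
move=> a b; elim/elim1: x => x; rewrite [RHS]/GRing.add /= !E; apply/pclassP.
apply: AC_trans (AC_mulDl _ _ _ _).
by apply: AC_mul; [apply: AC_cstD | apply: AC_refl].
Qed.

HB.instance Definition _ :=
  GRing.Zmodule_isLmodule.Build F presented pscaleA pscale1 pscaleDr pscaleDl.

Lemma pclassDE s t : pclass (Add s t) = pclass s + pclass t.
Proof. by rewrite -pclassD. Qed.
Lemma pclassME s t : pclass (Mul s t) = pclass s * pclass t.
Proof. by rewrite -pclassM. Qed.
Lemma pclassCE a : pclass (Cst a) = a *: (1 : presented).
Proof.
rewrite /GRing.scale /= /GRing.one /= pclassZ_def; apply/pclassP.
apply: AC_trans (AC_cstC _ _ _); exact/AC_sym/AC_mul1.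
Qed.

Lemma presented_scalerAl (a : F) (x y : presented) : a *: (x * y) = a *: x * y.
Proof.
elim/elim1: x => x; elim/elim1: y => y.
by rewrite /GRing.scale /GRing.mul /= !E; apply/pclassP/AC_mulA.
Qed.

Lemma presented_scalerAr (a : F) (x y : presented) : a *: (x * y) = x * (a *: y).
Proof.
elim/elim1: x => x; elim/elim1: y => y.
rewrite /GRing.scale /GRing.mul /= !E; apply/pclassP.
apply: AC_trans (AC_mulA _ _ _ _) _; apply: AC_trans (AC_sym (AC_mulA _ _ _ _)).
by apply: AC_mul; [apply: AC_cstC | apply: AC_refl].
Qed.

Lemma pclass_rel s t : rel s t -> pclass s = pclass t.
Proof. by move=> st; apply/pclassP/AC_rel. Qed.

End Presented.

Section QuotientModule.
Variables (F : fieldType) (M : lmodType F) (S : submodClosed M).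

Definition submod_pred : M -> bool := fun v => v \in S.
Fact submod_pred_zmod : zmod_closed submod_pred.
Proof.
split=> [|u v Su Sv]; first exact: (rpred0 S).
by apply: (rpredD (S := S)) => //; rewrite -scaleN1r; apply: (rpredZ (s := S)).
Qed.
HB.instance Definition _ := GRing.isZmodClosed.Build M submod_pred submod_pred_zmod.

Definition quotmod := Quotient.quot (GRing.ZmodClosed.clone M submod_pred _).
HB.instance Definition _ := GRing.Zmodule.on quotmod.

Definition qclass (v : M) : quotmod := \pi_quotmod v.

Lemma qclass_repr x : qclass (repr x) = x.
Proof. exact: reprK. Qed.

Lemma qclassP u v : qclass u = qclass v <-> u - v \in S.
Proof.
rewrite -[u - v \in S]/(Quotient.equiv (GRing.ZmodClosed.clone M submod_pred _) u v).
by split=> [/eqmodP|e]; [|apply/eqmodP].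
Qed.

Lemma qclass_is_zmod_morphism : zmod_morphism qclass.
Proof. by move=> u v; rewrite /qclass !piE. Qed.

Lemma qclassD_def u v : qclass (u + v) = qclass u + qclass v.
Proof. by rewrite /qclass !piE. Qed.

Definition qscale (a : F) (x : quotmod) : quotmod := qclass (a *: repr x).

Lemma qclassZ_def a v : qscale a (qclass v) = qclass (a *: v).
Proof.
by apply/qclassP; rewrite -scalerBr rpredZ //; apply/qclassP; rewrite qclass_repr.
Qed.

Fact qscaleA a b x : qscale a (qscale b x) = qscale (a * b) x.
Proof. by rewrite -[x]qclass_repr !qclassZ_def scalerA. Qed.
Fact qscale1 : left_id 1 qscale.
Proof. by move=> x; rewrite -[x]qclass_repr !qclassZ_def scale1r. Qed.
Fact qscaleDr : right_distributive qscale +%R.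
Proof.
move=> a x y; rewrite -[x]qclass_repr -[y]qclass_repr.
by rewrite -qclassD_def !qclassZ_def scalerDr qclassD_def.
Qed.
Fact qscaleDl x : {morph qscale^~ x : a b / a + b}.
Proof.
move=> a b; rewrite -[x]qclass_repr !qclassZ_def scalerDl.
exact: qclassD_def.
Qed.

HB.instance Definition _ :=
  GRing.Zmodule_isLmodule.Build F quotmod qscaleA qscale1 qscaleDr qscaleDl.

HB.instance Definition _ :=
  GRing.isZmodMorphism.Build M quotmod qclass qclass_is_zmod_morphism.

Fact qclass_is_scalable : scalable qclass.
Proof. by move=> a v; rewrite -qclassZ_def. Qed.

HB.instance Definition _ :=
  GRing.isScalable.Build F M quotmod _ qclass qclass_is_scalable.

End QuotientModule.

HB.mixin Record Lmodule_isLieAlgebra (F : fieldType) L of GRing.Lmodule F L := {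
  lie : L -> L -> L;
  lieDl : forall a x y z, lie (a *: x + y) z = a *: lie x z + lie y z;
  lieDr : forall a x y z, lie z (a *: x + y) = a *: lie z x + lie z y;
  liexx : forall x, lie x x = 0;
  lie_jacobi : forall x y z,
    lie x (lie y z) + lie y (lie z x) + lie z (lie x y) = 0
}.

#[short(type="lieAlgType")]
HB.structure Definition LieAlgebra (F : fieldType) :=
  {L of GRing.Lmodule F L & Lmodule_isLieAlgebra F L}.

Section Enveloping.
Variables (F : fieldType) (g : lieAlgType F).

Inductive env_rel : term F g -> term F g -> Prop :=
| ER_lin a x y :
    env_rel (Gen (a *: x + y)) (Add (Mul (Cst a) (Gen x)) (Gen y))
| ER_lie x y :
    env_rel (Gen (lie x y))
      (Add (Mul (Gen x) (Gen y)) (Mul (Cst (-1)) (Mul (Gen y) (Gen x)))).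

Definition Uenv := presented env_rel.
HB.instance Definition _ := GRing.PzRing.on Uenv.
HB.instance Definition _ := GRing.Lmodule.on Uenv.

Definition env_in (x : g) : Uenv := pclass env_rel (Gen x).

Fixpoint augment (t : term F g) : F :=
  match t with
  | Gen _ => 0
  | Cst a => a
  | Add s t => augment s + augment t
  | Mul s t => augment s * augment t
  end.

Lemma augment_congr s t : algebra_congr env_rel s t -> augment s = augment t.
Proof.
elim=> {s t} /=; try by move=> *; ring.
- by move=> s t [a x y|x y] /=; ring.
- by move=> s t _ ->.
- by move=> s t u _ -> _ ->.
- by move=> s s' t t' _ -> _ ->.
- by move=> s s' t t' _ -> _ ->.
Qed.

Fact Uenv_nontrivial : (1 : Uenv) != 0.
Proof.
apply/eqP => /pclassP/augment_congr /= /eqP; exact/negP/oner_neq0.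
Qed.

HB.instance Definition _ :=
  GRing.PzSemiRing_isNonZero.Build Uenv Uenv_nontrivial.
HB.instance Definition _ :=
  GRing.Lmodule_isLalgebra.Build F Uenv (@presented_scalerAl F g env_rel).
HB.instance Definition _ :=
  GRing.Lalgebra_isAlgebra.Build F Uenv (@presented_scalerAr F g env_rel).

Lemma env_in_lin a x y : env_in (a *: x + y) = a *: env_in x + env_in y.
Proof.
by rewrite {1}/env_in (pclass_rel (ER_lin a x y)) pclassDE pclassME pclassCE
           -presented_scalerAl mul1r.
Qed.

Lemma env_in_lie x y :
  env_in (lie x y) = env_in x * env_in y - env_in y * env_in x.
Proof.
by rewrite {1}/env_in (pclass_rel (ER_lie x y)) pclassDE !pclassME pclassCE
           -presented_scalerAl mul1r scaleN1r.
Qed.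

End Enveloping.

Definition two_sided_ideal (A : pzRingType) (I : A -> Prop) : Prop :=
  [/\ I 0, forall x y, I x -> I y -> I (x + y)
    & forall a x b, I x -> I (a * x * b)].

Definition ideal_generated (A : pzRingType) (S : A -> Prop) (u : A) : Prop :=
  forall I : A -> Prop, two_sided_ideal I -> (forall x, S x -> I x) -> I u.

Definition left_ideal (A : pzRingType) (I : A -> Prop) : Prop :=
  [/\ I 0, forall x y, I x -> I y -> I (x + y) & forall a x, I x -> I (a * x)].

Definition annihilator (A : pzRingType) (M : lmodType A) (u : A) : Prop :=
  forall v : M, u *: v = 0.

Definition simple_module (A : pzRingType) (M : lmodType A) : Prop :=
  (exists v : M, v <> 0) /\
  forall S : {pred M}, submod_closed S ->
    (forall v, v \in S -> v = 0) \/ (forall v, v \in S).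

(* An element of S^2(g) is a formal sum of products [x y], given as a sequence
   of pairs; [sym2_eq] is equality in S^2(g), tested against all symmetric
   bilinear maps (the universal property of S^2(g)). *)
Section SymmetricSquare.
Variables (F : fieldType) (g : lieAlgType F).

Definition sym2 := seq (g * g).

Definition symmetric_bilinear (W : lmodType F) (b : g -> g -> W) : Prop :=
  (forall a x y z, b (a *: x + y) z = a *: b x z + b y z) /\
  (forall x y, b x y = b y x).

Definition sym2_eq (v w : sym2) : Prop :=
  forall (W : lmodType F) (b : g -> g -> W), symmetric_bilinear b ->
    \sum_(p <- v) b p.1 p.2 = \sum_(p <- w) b p.1 p.2.

Definition sym2_scale (a : F) (w : sym2) : sym2 :=
  [seq (a *: p.1, p.2) | p <- w].

Definition sym2_ad (x : g) (w : sym2) : sym2 :=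
  [seq (lie x p.1, p.2) | p <- w] ++ [seq (p.1, lie x p.2) | p <- w].

End SymmetricSquare.

Section Affine.
Variables (F : fieldType) (g : lieAlgType F).
Variables (form : g -> g -> F) (k : F).

(* The generator [(x, n)] is x(n) = x (x) t^n; these are the relations of the
   enveloping algebra of the affine Lie algebra, with the central element
   specialized to the scalar k. *)
Inductive affine_rel : term F (g * int) -> term F (g * int) -> Prop :=
| AR_lin a x y n :
    affine_rel (Gen (a *: x + y, n))
      (Add (Mul (Cst a) (Gen (x, n))) (Gen (y, n)))
| AR_lie x y m n :
    affine_rel
      (Add (Mul (Gen (x, m)) (Gen (y, n)))
           (Mul (Cst (-1)) (Mul (Gen (y, n)) (Gen (x, m)))))
      (Add (Gen (lie x y, m + n))
           (Cst (if m + n == 0 then m%:~R * form x y * k else 0))).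

Definition Uaff := presented affine_rel.
HB.instance Definition _ := GRing.PzRing.on Uaff.
HB.instance Definition _ := GRing.Lmodule.on Uaff.

Definition aff (x : g) (n : int) : Uaff := pclass affine_rel (Gen (x, n)).

Lemma aff_lin a x y n : aff (a *: x + y) n = a *: aff x n + aff y n.
Proof.
by rewrite {1}/aff (pclass_rel (AR_lin a x y n)) pclassDE pclassME pclassCE
           -presented_scalerAl mul1r.
Qed.

Lemma aff_lie x y m n :
  aff x m * aff y n - aff y n * aff x m =
  aff (lie x y) (m + n) +
  (if m + n == 0 then m%:~R * form x y * k else 0) *: (1 : Uaff).
Proof.
have := pclass_rel (AR_lie x y m n).
by rewrite !pclassDE !pclassME !pclassCE -presented_scalerAl mul1r scaleN1r.
Qed.

Definition vac_ideal (u : Uaff) : bool :=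
  `[< forall I : Uaff -> Prop, left_ideal I ->
      (forall x (n : nat), I (aff x n%:Z)) -> I u >].

Lemma vac_ideal_left : left_ideal vac_ideal.
Proof.
split=> [|u v /asboolP Iu /asboolP Iv|a u /asboolP Iu];
  apply/asboolP=> I lI gI; have [I0 ID IM] := lI => //.
- by apply: ID; [apply: Iu|apply: Iv].
- by apply: IM; apply: Iu.
Qed.

Fact vac_ideal_submod : subsemimod_closed vac_ideal.
Proof.
have [I0 ID IM] := vac_ideal_left.
split=> [|a u Iu]; first by split=> //; exact: ID.
have -> : a *: u = (a *: (1 : Uaff)) * u.
  by rewrite -[in RHS]presented_scalerAl mul1r.
exact: IM.
Qed.

HB.instance Definition _ :=
  GRing.isSubmodClosed.Build F Uaff vac_ideal vac_ideal_submod.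

(* V^k(g) as the vacuum module: Uaff modulo its left ideal generated by g[t]. *)
Definition vac_submod : submodClosed Uaff :=
  GRing.SubmodClosed.clone F Uaff vac_ideal _.
Definition Vaff := quotmod vac_submod.
HB.instance Definition _ := GRing.Lmodule.on Vaff.

Definition act (u : Uaff) (v : Vaff) : Vaff := qclass vac_submod (u * repr v).

Lemma act_class u u' : act u (qclass vac_submod u') = qclass vac_submod (u * u').
Proof.
have [_ _ IM] := vac_ideal_left.
apply/qclassP; rewrite -mulrBr; apply: IM.
by apply/qclassP; rewrite qclass_repr.
Qed.

Definition vac : Vaff := qclass vac_submod 1.

Definition mode (x : g) (n : int) (v : Vaff) : Vaff := act (aff x n) v.

Inductive conformal_weight : nat -> Vaff -> Prop :=
| CW_zero n : conformal_weight n 0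
| CW_vac : conformal_weight 0 vac
| CW_lin n (a : F) u v : conformal_weight n u -> conformal_weight n v ->
    conformal_weight n (a *: u + v)
| CW_mode n m x v : conformal_weight n v ->
    conformal_weight (n + m.+1) (mode x (- m.+1%:Z) v).

(* [Y a n b] is the n-th product a_(n) b, i.e. Y(a,z) = \sum_n a_(n) z^(-n-1).
   The record lists the vertex algebra axioms (field property, vacuum,
   translation covariance for T a = a_(-2)|0>, and locality
   (z-w)^N [Y(a,z), Y(b,w)] = 0), together with Y(x(-1)|0>, z) = x(z), which
   singles out the affine vertex algebra structure. *)
Record affine_vertex_algebra (Y : Vaff -> int -> Vaff -> Vaff) : Prop := {
  va_linl : forall c a a' n b, Y (c *: a + a') n b = c *: Y a n b + Y a' n b;
  va_linr : forall c a n b b', Y a n (c *: b + b') = c *: Y a n b + Y a n b';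
  va_field : forall a b, exists N : int, forall n, N <= n -> Y a n b = 0;
  va_vacl : forall n b, Y vac n b = if n == -1 then b else 0;
  va_vacr : forall a, Y a (-1) vac = a;
  va_vacr0 : forall a (n : nat), Y a n%:Z vac = 0;
  va_translation : forall a n b,
    Y (Y a n b) (-2) vac - Y a n (Y b (-2) vac) = - (n%:~R *: Y a (n - 1) b);
  va_locality : forall a b, exists N : nat, forall (m n : int) c,
    \sum_(j < N.+1) ((-1) ^+ j * 'C(N, j)%:R) *:
      (Y a (m + N%:Z - j%:Z) (Y b (n + j%:Z) c)
       - Y b (n + j%:Z) (Y a (m + N%:Z - j%:Z) c)) = 0;
  va_gen : forall x n b, Y (mode x (-1) vac) n b = mode x n b
}.

Section Zhu.
Variable Y : Vaff -> int -> Vaff -> Vaff.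

(* For a of conformal weight n:
   a * b = Res_z Y(a,z) (1+z)^n / z b  and  a o b = Res_z Y(a,z) (1+z)^n / z^2 b. *)
Definition zhu_mul (n : nat) (a b : Vaff) : Vaff :=
  \sum_(i < n.+1) 'C(n, i)%:R *: Y a (i%:Z - 1) b.
Definition zhu_circ (n : nat) (a b : Vaff) : Vaff :=
  \sum_(i < n.+1) 'C(n, i)%:R *: Y a (i%:Z - 2) b.

Definition zhuO (u : Vaff) : bool :=
  `[< forall S : {pred Vaff}, submod_closed S ->
      (forall n a b, conformal_weight n a -> zhu_circ n a b \in S) -> u \in S >].

Fact zhuO_submod : subsemimod_closed zhuO.
Proof.
apply: GRing.submod_closed_semi; split=> [|c u v /asboolP Ou /asboolP Ov].
  by apply/asboolP=> S [S0 _] _.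
apply/asboolP=> S SS gS; case: (SS) => _; apply.
- exact: Ou.
- exact: Ov.
Qed.

HB.instance Definition _ :=
  GRing.isSubmodClosed.Build F Vaff zhuO zhuO_submod.

Definition zhuO_sub : submodClosed Vaff :=
  GRing.SubmodClosed.clone F Vaff zhuO _.
Definition zhu_algebra := quotmod zhuO_sub.
HB.instance Definition _ := GRing.Lmodule.on zhu_algebra.

Definition zhu_class (v : Vaff) : zhu_algebra := qclass zhuO_sub v.

(* theta is the algebra isomorphism A(V^k(g)) -> U(g) with [x(-1)|0>] |-> x. *)
Record zhu_identification (theta : zhu_algebra -> Uenv g) : Prop := {
  zi_linear : linear theta;
  zi_bijective : bijective theta;
  zi_one : theta (zhu_class vac) = 1;
  zi_mul : forall n a b, conformal_weight n a ->
    theta (zhu_class (zhu_mul n a b)) =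
    theta (zhu_class a) * theta (zhu_class b);
  zi_gen : forall x, theta (zhu_class (mode x (-1) vac)) = env_in x
}.

End Zhu.

(* [sigma_op w] is the element of U(t^-1 g[t^-1]) corresponding to sigma(w), so
   [sigma_pow w r] is the r-th power of sigma(w) computed in that algebra. *)
Definition sigma_op (w : sym2 g) : Uaff :=
  \sum_(p <- w) 2^-1 *: (aff p.1 (-1) * aff p.2 (-1) + aff p.2 (-1) * aff p.1 (-1)).

Definition sigma (w : sym2 g) : Vaff := act (sigma_op w) vac.

Definition sigma_pow (w : sym2 g) (r : nat) : Vaff := act (sigma_op w ^+ r) vac.

End Affine.

Section EvenOrthogonal.
Variables (F : fieldType) (l : nat).

(* so_{2l} for the split form pairing the i-th and (l+i)-th basis vectors, so
   that diagonal matrices form a Cartan subalgebra. *)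
Definition split_form : 'M[F]_(l + l) := block_mx 0 1%:M 1%:M 0.

Definition so_pred (A : 'M[F]_(l + l)) : bool :=
  A^T *m split_form + split_form *m A == 0.

Fact so_pred_submod : subsemimod_closed so_pred.
Proof.
apply: GRing.submod_closed_semi; split=> [|a A B /eqP hA /eqP hB].
  by rewrite unfold_in /so_pred trmx0 mul0mx mulmx0 addr0.
rewrite unfold_in /so_pred linearP mulmxDl mulmxDr -scalemxAl -scalemxAr.
by rewrite addrACA -scalerDr hA hB scaler0 addr0.
Qed.

HB.instance Definition _ :=
  GRing.isSubmodClosed.Build F 'M[F]_(l + l) so_pred so_pred_submod.

Record so := So { so_mx :> 'M[F]_(l + l); _ : so_pred so_mx }.
HB.instance Definition _ := [isSub for so_mx].
HB.instance Definition _ := [Choice of so by <:].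
HB.instance Definition _ := [SubChoice_isSubLmodule of so by <:].

Fact so_lie_subproof (A B : so) : so_pred (A *m B - B *m A).
Proof.
case: A B => [A /= /eqP hA] [B /= /eqP hB]; rewrite /so_pred; apply/eqP.
have {hA}hA : A^T *m split_form = - (split_form *m A).
  by apply/eqP; rewrite -addr_eq0 hA.
have {hB}hB : B^T *m split_form = - (split_form *m B).
  by apply/eqP; rewrite -addr_eq0 hB.
rewrite linearB /= !trmx_mul mulmxBl -!mulmxA hA hB !mulmxN !mulmxA hA hB.
by rewrite !mulNmx !opprK mulmxBr !mulmxA addrC -opprB addNr.
Qed.

Definition so_lie (A B : so) : so := So (so_lie_subproof A B).

Fact so_lieDl a (x y z : so) : so_lie (a *: x + y) z = a *: so_lie x z + so_lie y z.
Proof.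
apply: val_inj => /=; rewrite mulmxDl mulmxDr -scalemxAl -scalemxAr.
by rewrite scalerBr opprD addrACA.
Qed.
Fact so_lieDr a (x y z : so) : so_lie z (a *: x + y) = a *: so_lie z x + so_lie z y.
Proof.
apply: val_inj => /=; rewrite mulmxDl mulmxDr -scalemxAl -scalemxAr.
by rewrite scalerBr opprD addrACA.
Qed.
Fact so_liexx (x : so) : so_lie x x = 0.
Proof. by apply: val_inj => /=; rewrite subrr. Qed.
Fact so_jacobi (x y z : so) :
  so_lie x (so_lie y z) + so_lie y (so_lie z x) + so_lie z (so_lie x y) = 0.
Proof.
apply: val_inj => /=; rewrite !mulmxBr !mulmxBl !mulmxA.
case: x y z => [x ?] [y ?] [z ?] /=.
set a := x *m y *m z; set b := x *m z *m y; set c := y *m z *m x.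
set d := z *m y *m x; set e := y *m x *m z; set f := z *m x *m y.
rewrite !opprB; apply/matrixP=> i j; rewrite !mxE; ring.
Qed.

HB.instance Definition _ := Lmodule_isLieAlgebra.Build F so
  so_lieDl so_lieDr so_liexx so_jacobi.

(* The invariant form normalized so that roots have square length 2. *)
Definition so_inner (x y : so) : F := 2^-1 * \tr (so_mx x *m so_mx y).

Definition cartan (h : so) : bool := is_diag_mx (so_mx h).

(* Weights are row vectors of coordinates in the basis eps_1, ..., eps_l; the
   argument of [eps] and [simple_root] is 1-based, and [eps i] is 0 for i > l. *)
Definition weight_at (mu : 'rV[F]_l) (h : so) : F :=
  \sum_(i < l) mu 0 i * so_mx h (lshift l i) (lshift l i).

Definition eps (i : nat) : 'rV[F]_l := \row_(j < l) (j.+1 == i)%:R.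

Definition simple_root (i : nat) : 'rV[F]_l :=
  if (i < l)%N then eps i - eps i.+1 else eps l.-1 + eps l.

Definition root_vector (mu : 'rV[F]_l) (x : so) : Prop :=
  forall h, cartan h -> lie h x = weight_at mu h *: x.

Definition positive_root (mu : 'rV[F]_l) : Prop :=
  [/\ mu <> 0, exists2 x, x <> 0 & root_vector mu x
    & exists c : nat -> nat, mu = \sum_(1 <= i < l.+1) simple_root i *+ c i].

Definition is_simple_highest_weight_module
    (mu : 'rV[F]_l) (M : lmodType (Uenv so)) : Prop :=
  simple_module M /\
  exists v : M,
    [/\ v <> 0,
        forall alpha x, positive_root alpha -> root_vector alpha x ->
          env_in x *: v = 0
      & forall h, cartan h -> env_in h *: v = (weight_at mu h)%:A *: v].

Definition is_highest_weight_sym2 (mu : 'rV[F]_l) (w : sym2 so) : Prop :=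
  [/\ ~ sym2_eq w [::],
      forall alpha x, positive_root alpha -> root_vector alpha x ->
        sym2_eq (sym2_ad x w) [::]
    & forall h, cartan h -> sym2_eq (sym2_ad h w) (sym2_scale (weight_at mu h) w)].

Definition Vminus1 := Vaff so_inner (-1).

Definition I_cand (Y : Vminus1 -> int -> Vminus1 -> Vminus1)
    (theta : zhu_algebra Y -> Uenv so) (wA wD : sym2 so) (u : Uenv so) : Prop :=
  ideal_generated
    (fun z => z = theta (zhu_class Y (sigma_pow so_inner (-1) wA (l - 2)))
           \/ z = theta (zhu_class Y (sigma_pow so_inner (-1) wD 2))) u.

End EvenOrthogonal.

(* Main.v *)
(** Since the modes occurring in [s_A] and [s_D] commute, their Zhu classes are
    [Omega_A ^+ (l - 2)] and [Omega_D ^+ 2], where [Omega] is the symmetrization in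
    [U(g)] of the highest-weight vector of [S^2(g)].  A power [W] of such an [Omega]
    commutes with the Borel subalgebra up to scalars, so by the triangular
    decomposition it kills [L(lam)] as soon as [phi (W z v) = 0] for all [z] in
    [U(g)], for some [g]-module [N], not necessarily simple, with a vector [v] of
    weight [lam] killed by [n^+] and a functional [phi] such that [phi v = 1] and
    [phi (n^- N) = 0].

    For [lam = - alpha_2 = (- eps_1 - eps_2 + eps_3) + eps_1] take [N = P (x) C^(2l)],
    where [P] is a Fock module of the Weyl algebra of [C^(2l) (x) C^2], on which
    [so_(2l)] acts by [a_i b_j - a_j b_i].  The Pfaffians of these commuting minors
    vanish, hence [Omega_D] maps [N] into the sum of the [P (x) e_i], i <= l, on which it
    vanishes: [Omega_D ^+ 2 = 0] on [N].  On [U(g) v], which lies in the kernel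
    of the operators commuting with [so_(2l)] that contract [P] with [C^(2l)] or
    with itself, there are functionals [phi = phi_0, phi_1, ...] such that [phi_k o
    Omega_A] is [2 (l - 3 - k)] times [phi_(k+1)]; hence
    [phi o Omega_A ^+ (l - 2) = 0]. *)

Require Import Defs.
From HB Require Import structures.
From mathcomp Require Import all_boot all_order all_algebra.
From mathcomp Require Import boolp reals complex ring zify mpoly.
Import GRing.Theory.
Local Open Scope ring_scope.
Import Num.Theory Order.TTheory.
Set Implicit Arguments.
Unset Strict Implicit.
Unset Printing Implicit Defensive.

(** * The split orthogonal Lie algebra *)

(** The module [L] enters only through its highest weight and its simplicity; all computation takes
    place in [N]. The operators [a_i], [b_j] put so_(2l) in the Weyl algebra, where it commutes with
    the sl_2 spanned by the contractions a.a, a.b and b.b. On [P] alone Omega_D vanishes, and the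
    factor C^(2l), needed to reach the weight, costs one more power. For Omega_A the obstacle is
    that no power need vanish on [N]: only the component along [v] is controlled. Where a.a = 0 and
    the number operator is 1 - 2l, Omega_A acts on [P] as a_o^2 (b.b) + (2l - 2) a_o b_o up to a
    scalar, [o] being the index of eps_1. Both a_o and b_o are derivatives, and [phi] does not see
    b.b, so each application raises by one the order in two variables of the coefficient being read.
    The factor C^(2l) mixes in the coordinate opposite to [o]; the functionals phi_k carry a
    correction by that coordinate, forced by the requirement that the recursion close. The exponent
    l - 2 is the number of levels k = 0, ..., l - 3, the last of which has factor 0. *)

Section SplitOrthogonal.
Variables (F : numFieldType) (l : nat).
Local Notation n := (l + l)%N.

Definition dual (i : 'I_n) : 'I_n :=
  match split i with inl j => rshift l j | inr j => lshift l j end.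

Lemma dualL (j : 'I_l) : dual (lshift l j) = rshift l j.
Proof. by rewrite /dual (unsplitK (inl j)). Qed.

Lemma dualR (j : 'I_l) : dual (rshift l j) = lshift l j.
Proof. by rewrite /dual (unsplitK (inr j)). Qed.

Definition dualE := (dualL, dualR).

Lemma dualK : involutive dual.
Proof. by move=> i; case: (split_ordP i) => j ->; rewrite !dualE. Qed.

Lemma dual_eq i j : (dual i == j) = (i == dual j).
Proof. by rewrite -{1}[j]dualK (inj_eq (inv_inj dualK)). Qed.

Lemma dual_neq i : (dual i == i) = false.
Proof.
by case: (split_ordP i) => j ->; rewrite ?dualL ?dualR ?eq_rlshift ?eq_lrshift.
Qed.

Lemma split_formE i j : split_form F l i j = (i == dual j)%:R.
Proof.
rewrite /split_form.
case: (split_ordP i) => i' ->; case: (split_ordP j) => j' ->;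
rewrite ?block_mxEul ?block_mxEur ?block_mxEdl ?block_mxEdr ?dualL ?dualR !mxE;
by rewrite ?eq_rlshift ?eq_lrshift ?(inj_eq (@lshift_inj _ _))
  ?(inj_eq (@rshift_inj _ _)) ?eq_lshift ?eq_rshift.
Qed.

Lemma so_predP (x : 'M[F]_n) :
  reflect (forall i j, x i j = - x (dual j) (dual i)) (so_pred x).
Proof.
have E i j : (x^T *m split_form F l + split_form F l *m x) i j =
    x (dual j) i + x (dual i) j.
  rewrite mxE [(x^T *m _) i j]mxE [(_ *m x) i j]mxE.
  rewrite (bigD1 (dual j)) //= [X in _ + X](bigD1 (dual i)) //=.
  rewrite [x^T _ _]mxE !split_formE dualK !eqxx mulr1 mul1r.
  rewrite !big1 ?addr0 // => k kn; rewrite split_formE.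
    by rewrite -dual_eq eq_sym (negPf kn) mul0r.
  by rewrite (negPf kn) mulr0.
apply: (iffP eqP) => [e i j|e].
  by move/matrixP: e => /(_ (dual i) j); rewrite E mxE dualK addrC => /eqP; rewrite addr_eq0 => /eqP.
by apply/matrixP=> i j; rewrite E mxE e dualK addNr.
Qed.

Lemma so_dual (x : so F l) i j : so_mx x i j = - so_mx x (dual j) (dual i).
Proof. by case: x => x /= /so_predP. Qed.

(* The matrices [sogen i j] span so_(2l), each root space being hit twice since
   [sogen (dual j) (dual i) = - sogen i j]; [sogen i (dual i) = 0]. *)
Definition sogen_mx (i j : 'I_n) : 'M[F]_n := delta_mx i j - delta_mx (dual j) (dual i).

Lemma sogen_mx_so i j : so_pred (sogen_mx i j).
Proof.
apply/so_predP => p q; rewrite !mxE opprB.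
rewrite !(inj_eq (inv_inj dualK)) (dual_eq q i) (dual_eq p j).
by rewrite [(q == _) && _]andbC [(q == dual i) && _]andbC.
Qed.

Definition sogen i j : so F l := So (sogen_mx_so i j).

Lemma sogenE i j p q :
  so_mx (sogen i j) p q = ((p == i) && (q == j))%:R - ((p == dual j) && (q == dual i))%:R.
Proof. by rewrite /= !mxE. Qed.

Lemma so_mx_lin a (x y : so F l) : so_mx (a *: x + y) = a *: so_mx x + so_mx y.
Proof. by []. Qed.

HB.instance Definition _ :=
  GRing.isLinear.Build F (so F l) 'M[F]_n _ (@so_mx F l) so_mx_lin.

Lemma so_mxZ a (x : so F l) : so_mx (a *: x) = a *: so_mx x.
Proof. by []. Qed.

Lemma so_mx_sum (I : Type) (r : seq I) (P : pred I) (f : I -> so F l) :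
  so_mx (\sum_(i <- r | P i) f i) = \sum_(i <- r | P i) so_mx (f i).
Proof. exact: raddf_sum. Qed.

Lemma sogen_dual i j : sogen (dual j) (dual i) = - sogen i j.
Proof. by apply/val_inj; rewrite /= /sogen_mx !dualK opprB. Qed.

(** Antisymmetrizing the matrix-unit expansion under [(i, j) -> (dual j, dual i)], which negates the
    entries of [x], doubles it; hence the factor 1/2. *)
Lemma so_decomp (x : so F l) : x = 2^-1 *: \sum_i \sum_j so_mx x i j *: sogen i j.
Proof.
apply/val_inj; rewrite /= raddf_sum /=.
apply: (@scalerI _ _ 2); first by rewrite pnatr_eq0.
rewrite scalerA mulfV ?pnatr_eq0 // scale1r scaler_nat mulr2n.
have E : so_mx x = \sum_i \sum_j so_mx x i j *: delta_mx i j.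
  exact: matrix_sum_delta.
under [RHS]eq_bigr do rewrite raddf_sum /=.
under [RHS]eq_bigr do under eq_bigr do rewrite /= /sogen_mx scalerBr.
under [RHS]eq_bigr do rewrite sumrB.
rewrite sumrB -E; congr (_ + _).
rewrite {1}E exchange_big (reindex_inj (inv_inj dualK)) /= -sumrN.
apply: eq_bigr => i _; rewrite (reindex_inj (inv_inj dualK)) /= -sumrN.
by apply: eq_bigr => j _; rewrite so_dual !dualK scaleNr.
Qed.

(* The eigenvalue on the i-th basis vector of the Cartan element rho^vee, on which every
   simple root takes the value 1; [sogen i j] has degree [rho_check i - rho_check j]. *)
Definition rho_check (i : 'I_n) : int :=
  match split i with inl j => (l.-1%:Z - j%:Z)%R | inr j => (j%:Z - l.-1%:Z)%R end.

Lemma rho_checkL (j : 'I_l) : rho_check (lshift l j) = l.-1%:Z - j%:Z.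
Proof. by rewrite /rho_check (unsplitK (inl j)). Qed.

Lemma rho_checkR (j : 'I_l) : rho_check (rshift l j) = j%:Z - l.-1%:Z.
Proof. by rewrite /rho_check (unsplitK (inr j)). Qed.

Lemma rho_check_dual i : rho_check (dual i) = - rho_check i.
Proof.
by case: (split_ordP i) => j ->; rewrite dualE rho_checkL rho_checkR opprB.
Qed.

End SplitOrthogonal.

HB.instance Definition _ (F : fieldType) (g : lieAlgType F) :=
  GRing.isLinear.Build F g (Uenv g) _ (@env_in F g) (@env_in_lin F g).

(** * Extension of a Lie algebra representation to the enveloping algebra *)

Section RepresentationOfEnvelopingAlgebra.
Variables (F : fieldType) (g : lieAlgType F) (N : lmodType F).
Variable rho : g -> N -> N.
Hypothesis rho_linl : forall a x y p, rho (a *: x + y) p = a *: rho x p + rho y p.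
Hypothesis rho_linr : forall x, linear (rho x).
Hypothesis rho_lie : forall x y p, rho (lie x y) p = rho x (rho y p) - rho y (rho x p).

(** As [Uenv] is a quotient of terms, the action is defined on terms and descends by
    [term_op_congr]; linearity serves right distributivity and the centrality of scalars. *)
Fixpoint term_op (t : term F g) (p : N) : N :=
  match t with
  | Gen x => rho x p
  | Cst a => a *: p
  | Add s t => term_op s p + term_op t p
  | Mul s t => term_op s (term_op t p)
  end.

Lemma term_op_lin t : linear (term_op t).
Proof.
elim: t => [x|a|s IHs t IHt|s IHs t IHt] c p q /=.
- exact: rho_linr.
- by rewrite scalerDr !scalerA mulrC.
- by rewrite IHs IHt scalerDr addrACA.
- by rewrite IHt IHs.
Qed.

Lemma term_op_congr s t :
  algebra_congr (@env_rel F g) s t -> term_op s =1 term_op t.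
Proof.
have opD u p q : term_op u (p + q) = term_op u p + term_op u q.
  by have := term_op_lin u 1 p q; rewrite !scale1r.
have opZ u a p : term_op u (a *: p) = a *: term_op u p.
  have := term_op_lin u a p 0; rewrite !addr0 => ->.
  have := term_op_lin u 1 0 0; rewrite !scale1r addr0 => /eqP.
  by rewrite eq_sym -subr_eq0 addrK => /eqP ->; rewrite addr0.
elim=> {s t} //=.
- by move=> s t [a x y|x y] p /=; rewrite ?rho_linl // rho_lie scaleN1r.
- by move=> s t _ e p; rewrite e.
- by move=> s t u _ e1 _ e2 p; rewrite e1.
- by move=> s s' t t' _ e1 _ e2 p; rewrite e1 e2.
- by move=> s s' t t' _ e1 _ e2 p; rewrite e2 e1.
- by move=> s t u p; rewrite addrA.
- by move=> s t p; rewrite addrC.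
- by move=> t p; rewrite scale0r add0r.
- by move=> t p; rewrite !scale0r.
- by move=> t p; rewrite scale1r.
- by move=> s t u p; rewrite opD.
- by move=> a b p; rewrite scalerDl.
- by move=> a b p; rewrite scalerA.
- by move=> a t p; rewrite opZ.
Qed.

Definition env_op (u : Uenv g) : N -> N := term_op (repr u).

Lemma env_op_pclass t : env_op (pclass (@env_rel F g) t) =1 term_op t.
Proof. exact/term_op_congr/repr_pclass. Qed.

Lemma env_opZr u a p : env_op u (a *: p) = a *: env_op u p.
Proof.
have := term_op_lin (repr u) a p 0; rewrite !addr0 /env_op => ->.
have := term_op_lin (repr u) 1 0 0; rewrite !scale1r addr0 => /eqP.
by rewrite eq_sym -subr_eq0 addrK => /eqP ->; rewrite addr0.
Qed.

Lemma env_op_in x p : env_op (env_in x) p = rho x p.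
Proof. exact: env_op_pclass. Qed.

Lemma env_op1 p : env_op 1 p = p.
Proof. by rewrite env_op_pclass /= scale1r. Qed.

Lemma env_opM u v p : env_op (u * v) p = env_op u (env_op v p).
Proof.
rewrite -[u]pclass_repr -[v]pclass_repr -pclassME env_op_pclass /=.
by rewrite !env_op_pclass.
Qed.

Lemma env_opD u v p : env_op (u + v) p = env_op u p + env_op v p.
Proof.
rewrite -[u]pclass_repr -[v]pclass_repr -pclassDE env_op_pclass /=.
by rewrite !env_op_pclass.
Qed.

Lemma env_opZ a u p : env_op (a *: u) p = a *: env_op u p.
Proof.
rewrite -[u]mul1r scalerAl -pclassCE env_opM env_op_pclass /=.
by rewrite env_opM env_op1.
Qed.

Lemma env_op0 p : env_op 0 p = 0.
Proof. by rewrite -(scale0r (1 : Uenv g)) env_opZ scale0r. Qed.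

End RepresentationOfEnvelopingAlgebra.

(** * The adjoint action of the Cartan subalgebra and the principal grading *)

Section CartanAction.
Variables (F : numFieldType) (l : nat).
Local Notation n := (l + l)%N.

Lemma cartanP (h : so F l) :
  reflect (forall i j, i != j -> so_mx h i j = 0) (cartan h).
Proof. exact: is_diag_mxP. Qed.

Lemma cartan_lie (h x : so F l) p q : cartan h ->
  so_mx (lie h x) p q = (so_mx h p p - so_mx h q q) * so_mx x p q.
Proof.
move=> /cartanP dh; rewrite [LHS]/= [LHS]mxE [X in X + _]mxE [X in _ + X]mxE.
rewrite [(_ *m so_mx h) p q]mxE.
rewrite (bigD1 p) //= big1 => [|k kp]; last first.
  by rewrite dh 1?eq_sym // mul0r.
rewrite [X in _ - X](bigD1 q) //= big1 => [|k kq]; last by rewrite dh // mulr0.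
by rewrite !addr0 mulrBl [X in _ - X]mulrC.
Qed.

Lemma cartan_lie_sogen (h : so F l) i j : cartan h ->
  lie h (sogen F i j) = (so_mx h i i - so_mx h j j) *: sogen F i j.
Proof.
move=> ch; apply/val_inj/matrixP => p q.
rewrite [LHS](cartan_lie _ _ _ ch) [RHS]mxE !sogenE.
have key i' j' : (so_mx h p p - so_mx h q q) * ((p == i') && (q == j'))%:R =
    (so_mx h i' i' - so_mx h j' j') * ((p == i') && (q == j'))%:R.
  by case: eqP => [->|_]; case: eqP => [->|_]; rewrite ?mulr0.
rewrite !mulrBr !key [so_mx h (dual i) _]so_dual [so_mx h (dual j) _]so_dual.
by rewrite !dualK opprK [- _ + _]addrC.
Qed.

Lemma sogen_cartan i : cartan (sogen F i i : so F l).
Proof.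
apply/cartanP => p q pq; rewrite sogenE.
have -> : (p == i) && (q == i) = false.
  by apply/negP => /andP[/eqP ep /eqP eq]; rewrite ep eq eqxx in pq.
have -> : (p == dual i) && (q == dual i) = false.
  by apply/negP => /andP[/eqP ep /eqP eq]; rewrite ep eq eqxx in pq.
by rewrite subr0.
Qed.

(** [rho_check] is injective except for the value 0, shared by the last indices of the two blocks;
    these are dual to each other, so their [sogen] is 0. *)
Lemma sogen_same_height i j : rho_check i = rho_check j -> i = j \/ sogen F i j = 0 :> so F l.
Proof.
move=> e; have [->|ij] := eqVneq i j; [by left|right].
suff -> : j = dual i.
  by apply/val_inj; rewrite /= /sogen_mx dualK subrr.
case: (split_ordP i) e ij => i' ->; case: (split_ordP j) => j' ->;
  rewrite !(rho_checkL, rho_checkR, dualE) => e ij;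
  have := ltn_ord i'; have := ltn_ord j' => j'l i'l.
- by case/eqP: ij; congr (lshift _ _); apply/val_inj; move: e => /=; lia.
- by congr (rshift _ _); apply/val_inj; move: e => /=; lia.
- by congr (lshift _ _); apply/val_inj; move: e => /=; lia.
- by case/eqP: ij; congr (rshift _ _); apply/val_inj; move: e => /=; lia.
Qed.

Definition rho_check_elt : so F l :=
  \sum_(i < l) (rho_check (lshift l i))%:~R *: sogen F (lshift l i) (lshift l i).

Lemma rho_check_elt_cartan : cartan rho_check_elt.
Proof.
apply/cartanP => p q pq; rewrite /rho_check_elt so_mx_sum summxE big1 // => i _.
rewrite so_mxZ mxE /=.
by have /cartanP/(_ _ _ pq) -> := sogen_cartan (lshift l i); rewrite mulr0.
Qed.

Lemma rho_check_eltE i : so_mx rho_check_elt i i = (rho_check i)%:~R.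
Proof.
have E (j : 'I_l) : so_mx rho_check_elt (lshift l j) (lshift l j)
    = (rho_check (lshift l j))%:~R.
  rewrite /rho_check_elt so_mx_sum summxE (bigD1 j) // big1 => [|k kj].
    by rewrite so_mxZ mxE sogenE !eqxx eq_sym dual_neq subr0 mulr1 [LHS]addr0.
  rewrite so_mxZ mxE sogenE dualL eq_lrshift subr0.
  by rewrite (inj_eq (@lshift_inj _ _)) eq_sym (negPf kj) mulr0.
case: (split_ordP i) => j ->; first exact: E.
by rewrite so_dual dualR E -dualL rho_check_dual mulrNz.
Qed.

Lemma lie_rho_check i j : lie rho_check_elt (sogen F i j) =
  (rho_check i - rho_check j)%:~R *: sogen F i j.
Proof.
by rewrite (cartan_lie_sogen _ _ rho_check_elt_cartan) !rho_check_eltE mulrzBr.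
Qed.

End CartanAction.

(** * Triangular decomposition and highest-weight modules *)

Section Triangular.
Variables (F : numFieldType) (l : nat).
Local Notation n := (l + l)%N.
Local Notation U := (Uenv (so F l)).
Local Notation E i j := (env_in (sogen F i j) : U).

Inductive lowering_product : U -> Prop :=
| LP_one : lowering_product 1
| LP_mul i j X : rho_check i < rho_check j -> lowering_product X ->
    lowering_product (E i j * X).

(** Equality in the degree condition adds only Cartan elements and 0, by [sogen_same_height]. *)
Inductive borel_product : U -> Prop :=
| BP_one : borel_product 1
| BP_mul i j Y : rho_check j <= rho_check i -> borel_product Y ->
    borel_product (E i j * Y).

Inductive triangular : U -> Prop :=
| Tri_zero : triangular 0
| Tri_add c X Y u : lowering_product X -> borel_product Y -> triangular u ->
    triangular (c *: (X * Y) + u).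

Lemma triangular_lin c u w : triangular u -> triangular w -> triangular (c *: u + w).
Proof.
move=> tu tw; elim: tu => [|d X Y u' hX hY _ IH]; first by rewrite scaler0 add0r.
by rewrite scalerDr scalerA -addrA; apply: Tri_add.
Qed.

Lemma triangular_sum (I : Type) (r : seq I) (P : pred I) c (f : I -> U) :
  (forall i, triangular (f i)) -> triangular (\sum_(i <- r | P i) c i *: f i).
Proof.
move=> tf; elim: r => [|i r IH]; first by rewrite big_nil; apply: Tri_zero.
by rewrite big_cons; case: (P i) => //; apply: triangular_lin.
Qed.

Lemma triangular_lowering i j u : rho_check i < rho_check j ->
  triangular u -> triangular (E i j * u).
Proof.
move=> ij; elim=> [|c X Y u' hX hY _ IH]; first by rewrite mulr0; apply: Tri_zero.
rewrite mulrDr -scalerAr mulrA; apply: Tri_add => //; exact: LP_mul.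
Qed.

Lemma env_in_so (x : so F l) :
  env_in x = \sum_(p : 'I_n * 'I_n) (2^-1 * so_mx x p.1 p.2) *: E p.1 p.2.
Proof.
rewrite -(pair_bigA _ (fun i j => (2^-1 * so_mx x i j) *: E i j)) /=.
rewrite {1}[x]so_decomp linearZ raddf_sum /= scaler_sumr; apply: eq_bigr => i _ /=.
rewrite raddf_sum /= scaler_sumr; apply: eq_bigr => j _.
by rewrite linearZ_LR scalerA.
Qed.

(** Moving [x] past the first letter of [X] leaves a bracket, again an element of the Lie algebra,
    in front of a shorter word; hence the induction on [X] for all [x] at once. *)
Lemma triangular_env_in_word X : lowering_product X ->
  forall (x : so F l) Y, borel_product Y -> triangular (env_in x * (X * Y)).
Proof.
have red u : (forall i j, triangular (E i j * u)) ->
    forall x : so F l, triangular (env_in x * u).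
  move=> tG x; rewrite env_in_so mulr_suml.
  under eq_bigr do rewrite -scalerAl.
  exact: triangular_sum.
have one X1 Y1 : lowering_product X1 -> borel_product Y1 -> triangular (X1 * Y1).
  move=> hX hY; rewrite -[_ * _]scale1r -[_ *: _]addr0.
  by apply: Tri_add => //; apply: Tri_zero.
move=> hX; elim: {X} hX => [|i j X' ij hX' IH] x Y hY.
  move: x; apply: red => i j; rewrite mul1r.
  have [ji|ij] := leP (rho_check j) (rho_check i).
    by rewrite -[_ * _]mul1r; apply: one; [apply: LP_one|apply: BP_mul].
  by apply: triangular_lowering => //; rewrite -[Y]mul1r; apply: one => //; apply: LP_one.
have -> : env_in x * (E i j * X' * Y) =
    E i j * (env_in x * (X' * Y)) + env_in (lie x (sogen F i j)) * (X' * Y).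
  by rewrite env_in_lie mulrBl !mulrA addrC subrK.
rewrite -[E i j * _]scale1r; apply: triangular_lin; last exact: IH.
by apply: triangular_lowering => //; apply: IH.
Qed.

Lemma triangularP u : triangular u.
Proof.
have tG x w : triangular w -> triangular (env_in x * w).
  elim=> [|c X Y w' hX hY _ IH]; first by rewrite mulr0; apply: Tri_zero.
  rewrite mulrDr -scalerAr; apply: triangular_lin => //.
  exact: triangular_env_in_word.
rewrite -[u]mulr1 -[u]pclass_repr; set t := repr u; clearbody t.
have: triangular 1.
  rewrite -[1]mulr1 -[_ * _]scale1r -[_ *: _]addr0.
  by apply: Tri_add; [apply: LP_one|apply: BP_one|apply: Tri_zero].
(* The right factor 1 is generalized to any triangular element, so that the product case
   composes. *)
elim: t (1 : U) => [x|a|s IHs t IHt|s IHs t IHt] w tw.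
- exact: tG.
- rewrite pclassCE -scalerAl mul1r -[_ *: _]addr0.
  by apply: triangular_lin => //; apply: Tri_zero.
- rewrite pclassDE mulrDl -[_ * w]scale1r.
  by apply: triangular_lin; [apply: IHs|apply: IHt].
- by rewrite pclassME -mulrA; apply: IHs; apply: IHt.
Qed.

Lemma borel_product_commute w Y :
    (forall i j, rho_check j <= rho_check i -> exists z, E i j * w = w * z) ->
  borel_product Y -> exists z, Y * w = w * z.
Proof.
move=> hw; elim=> [|i j Y' ji _ [z e]]; first by exists 1; rewrite mul1r mulr1.
by have [z' e'] := hw _ _ ji; exists (z' * z); rewrite -mulrA e mulrA e' mulrA.
Qed.

End Triangular.

Section LowerEigenvectors.
Variables (F : numFieldType) (A : algType F) (M : lmodType A) (h : A) (lam : F).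

Inductive lower_sum : nat -> M -> Prop :=
| LS_zero : lower_sum 0 0
| LS_add k (m : int) x w : 0 < m -> h *: x = (lam - m%:~R)%:A *: x ->
    lower_sum k w -> lower_sum k.+1 (x + w).

Lemma alg_scaleC c (x : M) : h *: (c%:A *: x) = c%:A *: (h *: x).
Proof. by rewrite !scalerA mulr_algl mulr_algr. Qed.

Lemma lower_sum_shift k (m : int) w :
  lower_sum k w -> lower_sum k ((h - (lam - m%:~R)%:A) *: w).
Proof.
elim=> [|k' p x w' p0 hx _ IH]; first by rewrite scaler0; apply: LS_zero.
rewrite scalerDr; apply: (@LS_add _ p) => //.
rewrite scalerBl hx -scalerBl -(scalerBl (lam - p%:~R)) alg_scaleC hx.
by rewrite !scalerA !mulr_algl !scalerA mulrC.
Qed.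

(** The operator [h - (lam - m)] kills the first summand and multiplies the whole sum by [m], which
    is nonzero; so that multiple of the sum has one summand fewer. *)
Lemma lower_sum_top k w : lower_sum k w -> h *: w = lam%:A *: w -> w = 0.
Proof.
elim: k w => [|k IH] w.
  by move E : 0%N => k0 lw; case: lw E.
move E : k.+1 => k1 lw; case: lw E => // {}k1 m x w1 m0 hx lw [ek] hw; subst k1.
have E : (h - (lam - m%:~R)%:A) *: w1 = (m%:~R)%:A *: (x + w1).
  rewrite -[w1 in LHS](addKr x) scalerDr scalerN [in X in X + _]scalerBl hx subrr.
  by rewrite oppr0 add0r scalerBl hw -scalerBl -scalerBl opprB addrC subrK.
have := lower_sum_shift m lw; rewrite E => /IH.
rewrite alg_scaleC hw !scalerA !mulr_algl !scalerA mulrC => /(_ erefl) e.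
rewrite -[x + w1]scale1r -[1](scale1r (1 : A)) -(@mulVf _ m%:~R).
  by rewrite -scalerA -mulr_algl -scalerA e scaler0.
by rewrite intr_eq0 gt_eqF.
Qed.

End LowerEigenvectors.

Lemma simple_module_cyclic (A : pzRingType) (M : lmodType A) (x v : M) :
  simple_module M -> x <> 0 -> exists y, v = y *: x.
Proof.
move=> [_ Ms] x0; pose S : {pred M} := fun u => `[< exists y, u = y *: x >].
have SS : submod_closed S.
  split=> [|a u u' /asboolP[y ->] /asboolP[z ->]]; apply/asboolP.
    by exists 0; rewrite scale0r.
  by exists (a * y + z); rewrite [RHS]scalerDl -[in RHS]scalerA.
have [S0|ST] := Ms S SS; last exact/asboolP/ST.
by case: x0; apply: S0; apply/asboolP; exists 1; rewrite scale1r.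
Qed.

Section HighestWeightCriterion.
Variables (F : numFieldType) (l : nat).
Local Notation n := (l + l)%N.
Local Notation U := (Uenv (so F l)).
Local Notation E i j := (env_in (sogen F i j) : U).

Variables (N : lmodType F) (rho : so F l -> N -> N).
Hypothesis rho_linl : forall a x y p, rho (a *: x + y) p = a *: rho x p + rho y p.
Hypothesis rho_linr : forall x, linear (rho x).
Hypothesis rho_lie : forall x y p, rho (lie x y) p = rho x (rho y p) - rho y (rho x p).
Local Notation op := (env_op rho).

Variables (vN : N) (phi : N -> F) (lam : so F l -> F).
Hypothesis vN_raise : forall i j, rho_check j < rho_check i -> rho (sogen F i j) vN = 0.
Hypothesis vN_weight : forall i, rho (sogen F i i) vN = lam (sogen F i i) *: vN.
Hypothesis phi_lin : forall a p q, phi (a *: p + q) = a * phi p + phi q.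
Hypothesis phi_lower : forall i j p,
  rho_check i < rho_check j -> phi (rho (sogen F i j) p) = 0.
Hypothesis phi_vN : phi vN = 1.

Variables (L : lmodType U) (vL : L).
Hypothesis L_simple : simple_module L.
Hypothesis vL_neq0 : vL <> 0.
Hypothesis vL_raise : forall i j, rho_check j < rho_check i -> E i j *: vL = 0.
Hypothesis vL_weight : forall h, cartan h -> env_in h *: vL = (lam h)%:A *: vL.

Let h0 := rho_check_elt F l.

Let phi0 : phi 0 = 0.
Proof. by have := phi_lin (-1) 0 0; rewrite scaler0 addr0 mulN1r addNr. Qed.

(** Letters of positive degree kill both vectors and those of degree 0 act through the common weight
    [lam]: one scalar serves [L] and [N]. *)
Lemma borel_eigenvectors Y : borel_product Y ->
  exists c, Y *: vL = c%:A *: vL /\ op Y vN = c *: vN.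
Proof.
elim=> [|i j Y' ji _ [c [eL eN]]].
  by exists 1; rewrite !scale1r env_op1.
have [lt|ge] := ltP (rho_check j) (rho_check i).
  exists 0; rewrite env_opM // eN env_opZr // env_op_in // vN_raise // !scale0r scaler0.
  by rewrite -scalerA eL alg_scaleC vL_raise // scaler0.
have {ji ge} eh : rho_check i = rho_check j by apply/eqP; rewrite eq_le ge ji.
have [<-|G0] := sogen_same_height F eh.
  exists (c * lam (sogen F i i)); rewrite env_opM // eN env_opZr // env_op_in //.
  rewrite vN_weight scalerA; split=> //.
  rewrite -scalerA eL alg_scaleC vL_weight; last exact: sogen_cartan.
  by rewrite scalerA mulr_algl scalerA.
by exists 0; rewrite G0 linear0 mul0r env_op0 // !scale0r.
Qed.

(** The word 1 is set apart because any other lowering word contributes nothing to the top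
    coefficient, in [L] by its weight and in [N] by the choice of [phi]. *)
Lemma lowering_weight X : lowering_product X -> exists m : int,
  [/\ 0 <= m, env_in h0 *: (X *: vL) = (lam h0 - m%:~R)%:A *: (X *: vL)
    & X = 1 \/ 0 < m /\ forall p, phi (op X p) = 0].
Proof.
elim=> [|i j X' ij _ [m [m0 em _]]].
  exists 0; rewrite scale1r subr0 lexx; split=> //; last by left.
  exact/vL_weight/rho_check_elt_cartan.
exists (m + (rho_check j - rho_check i)); split.
- by rewrite addr_ge0 // subr_ge0 ltW.
- rewrite scalerA mulrA.
  have -> : env_in h0 * E i j = E i j * env_in h0
     + (rho_check i - rho_check j)%:~R *: E i j.
    have := congr1 (@env_in F (so F l)) (lie_rho_check F i j).
    by rewrite env_in_lie [RHS]linearZ_LR => <-; rewrite addrC subrK.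
  rewrite -[_ *: E i j]mulr_algl mulrDl scalerDl -!scalerA em alg_scaleC -scalerDl -scalerDl.
  by congr (_%:A *: _); rewrite !intrD !mulrNz; ring.
- right; split=> [|p]; first by rewrite ltr_wpDl // subr_gt0.
  by rewrite env_opM // env_op_in // phi_lower.
Qed.

(* [u] acts on the highest-weight vectors of [L] and of [N] by the same scalar, modulo
   lower weights in [L] and modulo the kernel of [phi] in [N]. *)
Lemma triangular_top u : triangular u -> exists c k w,
  [/\ lower_sum (env_in h0) (lam h0) k w, u *: vL = c%:A *: vL + w
    & phi (op u vN) = c].
Proof.
elim=> [|d X Y u' hX hY _ [c [k [w [lw eL ec]]]]].
  exists 0, 0%N, 0; split; first exact: LS_zero.
    by rewrite !scale0r addr0.
  by rewrite env_op0.
have [y [yL yN]] := borel_eigenvectors hY.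
have [m [m0 em [X1|[m_gt0 pX]]]] := lowering_weight hX.
  exists (d * y + c), k, w; split=> //.
    rewrite X1 mul1r [LHS]scalerDl eL addrA -[_ *: Y]mulr_algl -scalerA yL.
    by rewrite [_%:A *: (_ *: _)]scalerA mulr_algl scalerA -scalerDl -scalerDl.
  by rewrite env_opD // env_opZ // phi_lin X1 mul1r yN -[_ *: _]addr0 phi_lin phi0
    addr0 phi_vN mulr1 ec.
exists c, k.+1, ((d * y)%:A *: (X *: vL) + w); split.
- apply: (@LS_add _ _ _ _ _ _ m) => //.
  by rewrite alg_scaleC em !scalerA !mulr_algl !scalerA mulrC.
- rewrite [LHS]scalerDl eL [RHS]addrCA; congr (_ + _).
  by rewrite -[_ *: (X * Y)]mulr_algl -!scalerA yL alg_scaleC [LHS]scalerA mulr_algl scalerA.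
- by rewrite env_opD // env_opZ // phi_lin env_opM // pX mulr0 add0r.
Qed.

(** If [x *: vL] were nonzero, simplicity would give [y] with [y * x] fixing [vL]. Its top
    coefficient, computed in [N], is 0, so [vL] would be a sum of vectors of lower weight. *)
Lemma annihilates_top x : (forall y, phi (op (y * x) vN) = 0) -> x *: vL = 0.
Proof.
move=> hx; apply: contrapT => xv0.
have [y ey] := simple_module_cyclic vL L_simple xv0.
have [c [k [w [lw eL ec]]]] := triangular_top (triangularP (y * x)).
rewrite hx in ec; rewrite -scalerA -ey -ec !scale0r add0r in eL.
case: vL_neq0; rewrite eL; apply: lower_sum_top lw _; rewrite -eL.
exact/vL_weight/rho_check_elt_cartan.
Qed.

Lemma annihilates_of_top_functional w :
    (forall i j, rho_check j <= rho_check i -> exists z, E i j * w = w * z) ->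
    (forall z, phi (op (w * z) vN) = 0) ->
  annihilator L w.
Proof.
move=> hw phiw v.
have {v}[z ->] := simple_module_cyclic v L_simple vL_neq0; rewrite scalerA; apply: annihilates_top => y.
elim: (triangularP y) => [|c X Y u hX hY _ IH].
  by rewrite mul0r env_op0.
rewrite mulrDl env_opD // -scalerAl env_opZ // phi_lin IH addr0.
have [m [_ _ [X1|[_ pX]]]] := lowering_weight hX; last first.
  by rewrite -mulrA env_opM // pX mulr0.
have [z' e] := borel_product_commute hw hY.
by rewrite X1 mul1r mulrA e -mulrA phiw mulr0.
Qed.

End HighestWeightCriterion.

(** * The oscillator representation tensored with the vector representation *)

Section Oscillator.
Variables (F : numFieldType) (l : nat).
Local Notation n := (l + l)%N.
Variables (P : lmodType F) (a c : 'I_n -> {linear P -> P}).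
Hypothesis aC : forall i j p, a i (a j p) = a j (a i p).
Hypothesis cC : forall i j p, c i (c j p) = c j (c i p).
Hypothesis ca : forall i j p, c j (a i p) = a i (c j p) + (i == j)%:R *: p.

Lemma delta_sum (j : 'I_n) (f : 'I_n -> P) : \sum_i (i == j)%:R *: f i = f j.
Proof.
rewrite (bigD1 j) //= eqxx scale1r big1 ?addr0 // => i /negPf ->.
by rewrite scale0r.
Qed.

(* The a_i span C^(2l), the c_i the dual space: this is the oscillator representation
   of gl_(2l). *)
Definition osc (x : 'M[F]_n) (p : P) : P := \sum_i \sum_j x i j *: a i (c j p).

Fact osc_is_linear x : linear (osc x).
Proof.
move=> k p q; rewrite /osc scaler_sumr -big_split; apply: eq_bigr => i _ /=.
rewrite scaler_sumr -big_split; apply: eq_bigr => j _ /=.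
by rewrite !linearP.
Qed.
HB.instance Definition _ x := GRing.isLinear.Build F P P _ (osc x) (osc_is_linear x).

Lemma osc_linl k x y p : osc (k *: x + y) p = k *: osc x p + osc y p.
Proof.
rewrite /osc scaler_sumr -big_split; apply: eq_bigr => i _ /=.
rewrite scaler_sumr -big_split; apply: eq_bigr => j _ /=.
by rewrite !mxE scalerDl scalerA.
Qed.

Lemma osc_a x u p : osc x (a u p) = a u (osc x p) + \sum_i x i u *: a i p.
Proof.
rewrite /osc [X in _ = X + _]linear_sum -big_split; apply: eq_bigr => i _ /=.
rewrite -[X in _ + X](delta_sum u (fun j => x i j *: a i p)).
rewrite linear_sum -big_split; apply: eq_bigr => j _ /=.
rewrite ca linearD [a i (_ *: _)]linearZ_LR scalerDr [a u (_ *: _)]linearZ_LR /= (aC u) eq_sym.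
by congr (_ + _); rewrite !scalerA mulrC.
Qed.

Lemma osc_c x u p : osc x (c u p) = c u (osc x p) - \sum_j x u j *: c j p.
Proof.
apply/eqP; rewrite eq_sym subr_eq eq_sym; apply/eqP.
rewrite /osc exchange_big [RHS]linear_sum.
under [RHS]eq_bigr do rewrite linear_sum.
rewrite /= [RHS]exchange_big -big_split; apply: eq_bigr => j _ /=.
rewrite -[X in _ + X](delta_sum u (fun i => x i j *: c j p)).
rewrite -big_split; apply: eq_bigr => i _ /=.
by rewrite [c u (_ *: _)]linearZ_LR /= ca scalerDr cC; congr (_ + _); rewrite !scalerA mulrC.
Qed.

Lemma osc_lie x y p :
  osc (x *m y - y *m x) p = osc x (osc y p) - osc y (osc x p).
Proof.
(* Two groupings of the same product: [E] matches the bracket of [osc x] with the [a]'s, [E'] the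
   one with the [c]'s. *)
have E z w q : osc (z *m w) q = \sum_k \sum_j w k j *: \sum_i z i k *: a i (c j q).
  rewrite /osc; under eq_bigr do under eq_bigr do rewrite mxE scaler_suml.
  under eq_bigr do rewrite exchange_big /=.
  rewrite exchange_big /=; apply: eq_bigr => k _.
  rewrite exchange_big /=; apply: eq_bigr => j _; rewrite scaler_sumr.
  by apply: eq_bigr => i _; rewrite scalerA mulrC.
have E' z w q : osc (z *m w) q = \sum_i \sum_k z i k *: \sum_j w k j *: a i (c j q).
  rewrite /osc; apply: eq_bigr => i _.
  under eq_bigr do rewrite mxE scaler_suml.
  rewrite exchange_big /=; apply: eq_bigr => k _; rewrite scaler_sumr.
  by apply: eq_bigr => j _; rewrite scalerA.
have -> : x *m y - y *m x = -1 *: (y *m x) + x *m y by rewrite scaleN1r addrC.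
rewrite osc_linl scaleN1r (E _ x y) (E' _ y x).
apply/eqP; rewrite eq_sym subr_eq; apply/eqP.
rewrite {2}/osc linear_sum.
under eq_bigr do rewrite linear_sum.
rewrite /= [in RHS]/osc -sumrN -!big_split; apply: eq_bigr => k _ /=.
rewrite -sumrN -!big_split; apply: eq_bigr => j _ /=.
rewrite [osc x (_ *: _)]linearZ_LR /= osc_a osc_c linearB linear_sum /= scalerDr scalerBr.
rewrite [RHS]addrC [RHS]addrA; congr (_ - _ *: _ + _).
by rewrite [LHS]linear_sum; apply: eq_bigr => i _; rewrite [LHS]linearZ_LR.
Qed.

Lemma osc_delta i j p : osc (delta_mx i j) p = a i (c j p).
Proof.
rewrite /osc (bigD1 i) //= (bigD1 j) //= mxE !eqxx scale1r.
rewrite !big1 ?addr0 // => [k ki|k kj]; last by rewrite mxE (negPf kj) andbF scale0r.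
by apply: big1 => m _; rewrite mxE (negPf ki) scale0r.
Qed.

Lemma osc_sogen i j p : osc (sogen_mx F i j) p = a i (c j p) - a (dual j) (c (dual i) p).
Proof.
have -> : sogen_mx F i j = -1 *: delta_mx (dual j) (dual i) + delta_mx i j.
  by rewrite scaleN1r addrC.
by rewrite osc_linl !osc_delta scaleN1r addrC.
Qed.

(** The diagonal action on [P (x) C^(2l)], a tensor being encoded by its coordinates in the standard
    basis. *)
Definition tensor_act (x : so F l) (p : {ffun 'I_n -> P}) : {ffun 'I_n -> P} :=
  [ffun t => osc (so_mx x) (p t) + \sum_s so_mx x t s *: p s].

Fact tensor_act_is_linear x : linear (tensor_act x).
Proof.
move=> k p q; apply/ffunP => t; rewrite !ffunE linearP scalerDr addrACA.
congr (_ + _); rewrite scaler_sumr -big_split; apply: eq_bigr => s _ /=.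
by rewrite !ffunE linearP scalerA mulrC -scalerA.
Qed.
HB.instance Definition _ x :=
  GRing.isLinear.Build F _ _ _ (tensor_act x) (tensor_act_is_linear x).

Lemma tensor_act_linl k x y p :
  tensor_act (k *: x + y) p = k *: tensor_act x p + tensor_act y p.
Proof.
apply/ffunP => t; rewrite !ffunE osc_linl scalerDr addrACA; congr (_ + _).
rewrite scaler_sumr -big_split; apply: eq_bigr => s _ /=.
by rewrite !mxE scalerDl scalerA.
Qed.

Lemma tensor_act_lie x y p : tensor_act (lie x y) p =
  tensor_act x (tensor_act y p) - tensor_act y (tensor_act x p).
Proof.
have E z w q t : tensor_act z (tensor_act w q) t = osc (so_mx z) (osc (so_mx w) (q t))
   + (\sum_s so_mx w t s *: osc (so_mx z) (q s) + \sum_s so_mx z t s *: osc (so_mx w) (q s))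
   + \sum_s (so_mx z *m so_mx w) t s *: q s.
  rewrite !ffunE linearD /= -!addrA; congr (_ + _).
  rewrite linear_sum; under [X in X + _ = _]eq_bigr do rewrite linearZ_LR.
  congr (_ + _); under eq_bigr do rewrite ffunE scalerDr.
  rewrite big_split; congr (_ + _) => /=.
  under eq_bigr do rewrite scaler_sumr.
  rewrite exchange_big; apply: eq_bigr => s _ /=; rewrite mxE scaler_suml.
  by apply: eq_bigr => r _; rewrite scalerA.
have H (u u' s m m' : P) : u + s + m - (u' + s + m') = u - u' + (m - m').
  by rewrite opprD addrACA opprD [X in X + _ = _]addrACA subrr addr0.
apply/ffunP => t; rewrite [RHS]ffunE [X in _ = _ + X]ffunE !E ffunE osc_lie.
rewrite [X in _ = _ - (_ + X + _)]addrC H.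
congr (_ + _); rewrite -sumrB; apply: eq_bigr => s _.
by rewrite /= mxE [X in _ + X]mxE scalerDl scaleNr.
Qed.

Lemma tensor_act_sogen i j p t : tensor_act (sogen F i j) p t = osc (sogen_mx F i j) (p t)
  + (t == i)%:R *: p j - (t == dual j)%:R *: p (dual i).
Proof.
rewrite ffunE -addrA; congr (_ + _).
under eq_bigr do rewrite sogenE scalerBl.
rewrite sumrB; congr (_ - _).
  rewrite -[RHS](delta_sum j (fun s => (t == i)%:R *: p s)).
  apply: eq_bigr => s _; rewrite scalerA -natrM; congr (_ *: _).
  by case: (t == i); case: (s == j).
rewrite -[RHS](delta_sum (dual i) (fun s => (t == dual j)%:R *: p s)).
apply: eq_bigr => s _; rewrite scalerA -natrM; congr (_ *: _).
by case: (t == dual j); case: (s == dual i).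
Qed.

(** * Vanishing of Pfaffians of 2 x 2 minors *)

Section Pfaffian.
Variable tau : 'I_l -> 'I_l -> 'I_l -> 'I_l -> F.
Hypothesis tau12 : forall i j k m, tau i j k m = - tau j i k m.
Hypothesis tau23 : forall i j k m, tau i j k m = - tau i k j m.
Hypothesis tau34 : forall i j k m, tau i j k m = - tau i j m k.

Definition tau_sum (f : 'I_l -> 'I_l -> 'I_l -> 'I_l -> P) : P :=
  \sum_i \sum_j \sum_k \sum_m tau i j k m *: f i j k m.

Lemma eq_tau_sum f g : (forall i j k m, f i j k m = g i j k m) ->
  tau_sum f = tau_sum g.
Proof.
move=> e; apply: eq_bigr => i _; apply: eq_bigr => j _; apply: eq_bigr => k _.
by apply: eq_bigr => m _; rewrite e.
Qed.

Lemma tau_sumB f g :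
  tau_sum (fun i j k m => f i j k m - g i j k m) = tau_sum f - tau_sum g.
Proof.
rewrite /tau_sum -sumrB; apply: eq_bigr => i _; rewrite -sumrB.
apply: eq_bigr => j _; rewrite -sumrB; apply: eq_bigr => k _; rewrite -sumrB.
by apply: eq_bigr => m _; rewrite scalerBr.
Qed.

Lemma opp_eq0 (x : P) : x = - x -> x = 0.
Proof.
move=> /eqP; rewrite -addr_eq0 -mulr2n -scaler_nat scaler_eq0 pnatr_eq0 /=.
by move/eqP.
Qed.

Lemma tau_sum_swap12 f : tau_sum (fun i j => f j i) = - tau_sum f.
Proof.
rewrite /tau_sum exchange_big -sumrN; apply: eq_bigr => i _ /=.
rewrite -sumrN; apply: eq_bigr => j _; rewrite -sumrN; apply: eq_bigr => k _.
by rewrite -sumrN; apply: eq_bigr => m _; rewrite tau12 scaleNr.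
Qed.

Lemma tau_sum_swap34 f : tau_sum (fun i j k m => f i j m k) = - tau_sum f.
Proof.
rewrite /tau_sum -sumrN; apply: eq_bigr => i _ /=.
rewrite -sumrN; apply: eq_bigr => j _; rewrite exchange_big -sumrN.
apply: eq_bigr => k _ /=; rewrite -sumrN; apply: eq_bigr => m _.
by rewrite tau34 scaleNr.
Qed.

(** Exchanging the first and third indices is the odd permutation (12)(23)(12), so [tau] changes
    sign while [f] does not. *)
Lemma tau_sum_sym f : (forall i j k m, f i j k m = f k j i m) -> tau_sum f = 0.
Proof.
move=> fs; apply: opp_eq0.
have E g : tau_sum (fun i j k => g i k j) = - tau_sum g.
  rewrite /tau_sum -sumrN; apply: eq_bigr => i _ /=.
  rewrite exchange_big -sumrN; apply: eq_bigr => j _ /=; rewrite -sumrN.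
  apply: eq_bigr => k _ /=; rewrite -sumrN; apply: eq_bigr => m _.
  by rewrite tau23 scaleNr.
rewrite [LHS](eq_tau_sum fs) (tau_sum_swap12 (fun i j k m => f k i j m)).
by rewrite (E (fun i j k m => f j i k m)) (tau_sum_swap12 f) opprK.
Qed.

Definition pfaffian_op (p : {ffun 'I_n -> P}) : {ffun 'I_n -> P} :=
  \sum_i \sum_j \sum_k \sum_m tau i j k m *:
    tensor_act (sogen F (lshift l i) (rshift l j))
      (tensor_act (sogen F (lshift l k) (rshift l m)) p).

Lemma osc_raise i j q : osc (sogen_mx F (lshift l i) (rshift l j)) q =
  a (lshift l i) (c (rshift l j) q) - a (lshift l j) (c (rshift l i) q).
Proof. by rewrite osc_sogen !dualE. Qed.

(** A product of two minors expands into four terms of the shape [a_i a_k c_j c_m]. Since the [a]'s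
    commute, [f] is symmetric in [i] and [k], and the other three terms differ from it by exchanges
    inside a pair. *)
Lemma osc_pfaffian q : tau_sum (fun i j k m =>
  osc (sogen_mx F (lshift l i) (rshift l j)) (osc (sogen_mx F (lshift l k) (rshift l m)) q)) = 0.
Proof.
pose f i j k m := a (lshift l i) (a (lshift l k) (c (rshift l j) (c (rshift l m) q))).
have f0 : tau_sum f = 0 by apply: tau_sum_sym => i j k m; rewrite /f aC.
have E i j k m : osc (sogen_mx F (lshift l i) (rshift l j))
      (osc (sogen_mx F (lshift l k) (rshift l m)) q)
    = (f i j k m - f i j m k) - (f j i k m - f j i m k).
  have caC u v p : c (rshift l u) (a (lshift l v) p) = a (lshift l v) (c (rshift l u) p).
    by rewrite ca eq_lrshift scale0r addr0.
  by rewrite !osc_raise !linearB /= !caC.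
rewrite (eq_tau_sum E) !tau_sumB.
rewrite (tau_sum_swap34 f) (tau_sum_swap12 (fun i j k m => f i j m k)).
by rewrite (tau_sum_swap12 f) (tau_sum_swap34 f) f0 !oppr0 subrr.
Qed.

Lemma pfaffian_opE p t : pfaffian_op p t = tau_sum (fun i j k m =>
  tensor_act (sogen F (lshift l i) (rshift l j))
      (tensor_act (sogen F (lshift l k) (rshift l m)) p) t).
Proof.
rewrite /pfaffian_op /tau_sum sum_ffunE; apply: eq_bigr => i _.
rewrite sum_ffunE; apply: eq_bigr => j _; rewrite sum_ffunE.
apply: eq_bigr => k _; rewrite sum_ffunE; apply: eq_bigr => m _.
by rewrite ffunE.
Qed.

(** The raising matrices map C^(2l) into the span of the left block, so a right-block coordinate
    feels only the oscillator part. *)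
Lemma tensor_act_raise_rshift i j p t :
  tensor_act (sogen F (lshift l i) (rshift l j)) p (rshift l t) =
  osc (sogen_mx F (lshift l i) (rshift l j)) (p (rshift l t)).
Proof.
by rewrite tensor_act_sogen !dualE !eq_rlshift !scale0r addr0 subr0.
Qed.

Lemma pfaffian_op_sqr p : pfaffian_op (pfaffian_op p) = 0.
Proof.
set q := pfaffian_op p.
have q0 t : q (rshift l t) = 0.
  rewrite pfaffian_opE -(osc_pfaffian (p (rshift l t))).
  by apply: eq_tau_sum => i j k m; rewrite !tensor_act_raise_rshift.
have E i j (p' : {ffun 'I_n -> P}) t : (forall t, p' (rshift l t) = 0) ->
    tensor_act (sogen F (lshift l i) (rshift l j)) p' t =
    osc (sogen_mx F (lshift l i) (rshift l j)) (p' t).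
  by move=> p0; rewrite tensor_act_sogen !dualE !p0 !scaler0 addr0 subr0.
apply/ffunP => t; rewrite pfaffian_opE ffunE -(osc_pfaffian (q t)).
apply: eq_tau_sum => i j k m; rewrite !E // => t'.
by rewrite tensor_act_raise_rshift q0 linear0.
Qed.

End Pfaffian.

(** * The quadric operator on harmonic tensors *)

Section QuadricOperator.
Variable o : 'I_n.
Local Notation o' := (dual o).

Definition creation_square q : P := \sum_u a u (a (dual u) q).
Definition annihilation_square q : P := \sum_u c u (c (dual u) q).
Definition number_op q : P := \sum_u a u (c u q).

(* The operators involved commute with so_(2l): contraction of P with the second tensor
   factor by the a's and by the b's (with b_t = c_(dual t)), and two elements of gl_2. *)
Definition harmonic (p : {ffun 'I_n -> P}) : Prop :=
  [/\ \sum_t a t (p t) = 0, \sum_t c (dual t) (p t) = 0,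
      forall t, creation_square (p t) = 0
    & forall t, number_op (p t) = (1 - n%:R) *: p t].

(** For [o] the index of eps_1 this is, up to a scalar, the action of the symmetrized vector of
    weight [2 eps_1]; see [quadric_sym2]. *)
Definition quadric_op (p : {ffun 'I_n -> P}) : {ffun 'I_n -> P} :=
  \sum_u tensor_act (sogen F o u) (tensor_act (sogen F o (dual u)) p).

Lemma number_opE q : number_op q = osc 1%:M q.
Proof.
rewrite /number_op /osc; apply: eq_bigr => u _.
rewrite -[LHS](delta_sum u (fun j => a u (c j q))).
by apply: eq_bigr => j _; rewrite mxE eq_sym.
Qed.

Lemma number_op_c u q : number_op (c u q) = c u (number_op q) - c u q.
Proof.
rewrite !number_opE osc_c; congr (_ - _).
rewrite -[RHS](delta_sum u (fun j => c j q)).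
by apply: eq_bigr => j _; rewrite mxE eq_sym.
Qed.

Lemma osc_creation_square (x : so F l) q :
  osc (so_mx x) (creation_square q) = creation_square (osc (so_mx x) q).
Proof.
pose S := \sum_u \sum_i so_mx x i (dual u) *: a u (a i q).
(* The coefficients [x i (dual u)] are antisymmetric in [i] and [u], while [a u] and [a i]
   commute. *)
have S0 : S = 0.
  apply: opp_eq0; rewrite {1}/S exchange_big -sumrN; apply: eq_bigr => u _ /=.
  rewrite -sumrN; apply: eq_bigr => i _.
  by rewrite so_dual dualK scaleNr aC.
have E u : osc (so_mx x) (a u (a (dual u) q)) =
    a u (a (dual u) (osc (so_mx x) q))
    + \sum_i so_mx x i (dual u) *: a u (a i q)
    + \sum_i so_mx x i u *: a i (a (dual u) q).
  rewrite osc_a osc_a linearD; congr (_ + _ + _).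
  by rewrite linear_sum; apply: eq_bigr => i _; rewrite linearZ_LR.
rewrite /creation_square linear_sum (eq_bigr _ (fun u _ => E u)).
rewrite [LHS]big_split /= [X in X + _]big_split /= -/S S0 addr0.
rewrite [X in _ + X](reindex_inj (inv_inj (@dualK l))) /=.
rewrite [X in _ + X](_ : _ = S) ?S0 ?addr0 //.
by rewrite -[RHS]S0 /S; apply: eq_bigr => u _; apply: eq_bigr => i _; rewrite dualK aC.
Qed.

Lemma creation_square_linear : linear creation_square.
Proof.
move=> k u v; rewrite /creation_square scaler_sumr -big_split /=.
by apply: eq_bigr => i _; rewrite !linearP.
Qed.

Lemma harmonic_tensor_act (x : so F l) p : harmonic p -> harmonic (tensor_act x p).
Proof.
move=> [ha hc hE hN]; split.
- transitivity (osc (so_mx x) (\sum_t a t (p t))); last by rewrite ha linear0.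
  have E t : a t (tensor_act x p t) =
      a t (osc (so_mx x) (p t)) + \sum_s so_mx x t s *: a t (p s).
    rewrite ffunE linearD; congr (_ + _); rewrite linear_sum.
    by apply: eq_bigr => s _; rewrite linearZ_LR.
  rewrite (eq_bigr _ (fun t _ => E t)) [LHS]big_split [RHS]linear_sum /=.
  rewrite (eq_bigr _ (fun t _ => osc_a (so_mx x) t (p t))) [RHS]big_split /=.
  by congr (_ + _); rewrite exchange_big.
- transitivity (osc (so_mx x) (\sum_t c (dual t) (p t))); last by rewrite hc linear0.
  have E t : c (dual t) (tensor_act x p t) =
      c (dual t) (osc (so_mx x) (p t)) + \sum_s so_mx x t s *: c (dual t) (p s).
    rewrite ffunE linearD; congr (_ + _); rewrite linear_sum.
    by apply: eq_bigr => s _; rewrite linearZ_LR.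
  rewrite (eq_bigr _ (fun t _ => E t)) [LHS]big_split [RHS]linear_sum /=.
  rewrite (eq_bigr _ (fun t _ => osc_c (so_mx x) (dual t) (p t))) [RHS]big_split /=.
  congr (_ + _); rewrite exchange_big /=; apply: eq_bigr => t _.
  (* The [c]'s transform by the dual representation, which the split form identifies with C^(2l);
     this uses that [x] is in so_(2l). *)
  rewrite (reindex_inj (inv_inj (@dualK l))) -sumrN.
  by apply: eq_bigr => s _ /=; rewrite dualK so_dual scaleNr dualK.
- have csl := creation_square_linear.
  move=> t; rewrite ffunE -[osc _ _]scale1r csl -osc_creation_square hE linear0.
  rewrite scaler0 add0r; elim/big_rec: _ => [|s y _ IH].
    by have := csl (-1) 0 0; rewrite scaler0 addr0 scaleN1r addNr.
  by rewrite csl hE scaler0 add0r.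
(* The number operator is [osc] of the identity matrix, which commutes with every matrix. *)
- move=> t; rewrite number_opE ffunE linearD scalerDr; congr (_ + _).
    have := osc_lie 1%:M (so_mx x) (p t).
    rewrite mul1mx mulmx1 subrr -[0 : 'M__](scale0r 0) -[0 *: 0]addr0.
    rewrite osc_linl scale0r add0r.
    have -> : osc 0 (p t) = 0.
      by rewrite /osc big1 // => i _; rewrite big1 // => j _; rewrite mxE scale0r.
    by move/esym/eqP; rewrite subr_eq0 -[osc 1%:M (p t)]number_opE hN linearZ_LR => /eqP.
  rewrite /= [osc _ _]linear_sum scaler_sumr; apply: eq_bigr => s _.
  by rewrite /= [osc _ _]linearZ_LR /= -number_opE hN !scalerA mulrC.
Qed.

Lemma number_op_caE y : \sum_u c u (a u y) = number_op y + n%:R *: y.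
Proof.
have -> : n%:R *: y = \sum_(u < n) y by rewrite sumr_const card_ord scaler_nat.
rewrite -big_split; apply: eq_bigr => u _ /=.
by rewrite ca eqxx scale1r.
Qed.

Lemma dual_o : (o == o') = false.
Proof. by rewrite eq_sym dual_neq. Qed.

Lemma c'_a_o q : c o' (a o q) = a o (c o' q).
Proof. by rewrite ca dual_o scale0r addr0. Qed.

Lemma creation_square_c' q : creation_square (c o' q) =
  c o' (creation_square q) - 2 *: a o q.
Proof.
have aC' u y : a u (c o' y) = c o' (a u y) - (u == o')%:R *: y.
  by rewrite ca addrK.
rewrite /creation_square.
have E u : a u (a (dual u) (c o' q)) = c o' (a u (a (dual u) q))
   - (u == o')%:R *: a (dual u) q - (u == o)%:R *: a u q.
  by rewrite aC' linearB linearZ_LR /= aC' (inj_eq (inv_inj (@dualK l))).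
rewrite (eq_bigr _ (fun u _ => E u)) sumrB sumrB -linear_sum.
by rewrite !delta_sum dualK -addrA -opprD -mulr2n scaler_nat.
Qed.

(** Each factor is a difference of two terms, whence four sums. Their multiples of [a o (c o' q)]
    add up to 1 - 0 + n - 3 = n - 2. *)
Lemma osc_quadric q : creation_square q = 0 -> number_op q = (1 - n%:R) *: q ->
  \sum_u osc (sogen_mx F o u) (osc (sogen_mx F o (dual u)) q) =
  a o (a o (annihilation_square q)) + (n%:R - 2) *: a o (c o' q).
Proof.
move=> hE hN.
have N' : number_op (c o' q) = - n%:R *: c o' q.
  by rewrite number_op_c hN linearZ_LR -scaleN1r -scalerDl; congr (_ *: _); ring.
have S1 : \sum_u a o (c u (a o (c (dual u) q))) =
    a o (a o (annihilation_square q)) + a o (c o' q).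
  rewrite -linear_sum -linearD; congr (a o _).
  rewrite /annihilation_square linear_sum /= -[X in _ + X](delta_sum o (fun u => c (dual u) q)).
  by rewrite -big_split; apply: eq_bigr => u _ /=; rewrite ca eq_sym.
(* The eigenvalue [1 - n] matters here: [c o'] lowers it to [- n], which cancels the normal-ordering
   constant [n]. *)
have S2 : \sum_u a o (c u (a u (c o' q))) = 0.
  by rewrite -linear_sum /= number_op_caE N' -scalerDl addNr scale0r linear0.
have S3 : \sum_u a (dual u) (c o' (a o (c (dual u) q))) = - n%:R *: a o (c o' q).
  rewrite -linearZ_LR -N' /number_op linear_sum (reindex_inj (inv_inj (@dualK l))) /=.
  by apply: eq_bigr => u _; rewrite dualK c'_a_o aC cC.
(* Reordering exposes [creation_square q], which is 0; the 3 is 2 from its commutator with [c o']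
   and 1 from moving [a (dual u)] inside. *)
have S4 : \sum_u a (dual u) (c o' (a u (c o' q))) = - 3 *: a o (c o' q).
  have E u : a (dual u) (c o' (a u (c o' q))) =
      c o' (a u (a (dual u) (c o' q))) - (u == o)%:R *: a u (c o' q).
    by rewrite (aC u) (ca (dual u)) (inj_eq (inv_inj (@dualK l))) addrK.
  rewrite (eq_bigr _ (fun u _ => E u)) sumrB -linear_sum delta_sum /=.
  rewrite -[\sum_u _]/(creation_square (c o' q)) creation_square_c' hE linear0 sub0r.
  rewrite linearN linearZ_LR /= c'_a_o -!scaleNr -[X in _ - X]scale1r -scalerBl.
  by congr (_ *: _); ring.
have E u : osc (sogen_mx F o u) (osc (sogen_mx F o (dual u)) q) =
    (a o (c u (a o (c (dual u) q))) - a o (c u (a u (c o' q))))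
    - (a (dual u) (c o' (a o (c (dual u) q))) - a (dual u) (c o' (a u (c o' q)))).
  by rewrite !osc_sogen dualK !linearB.
rewrite (eq_bigr _ (fun u _ => E u)) sumrB sumrB [X in _ - X]sumrB S1 S2 S3 S4 subr0.
rewrite -addrA; congr (_ + _); rewrite -[X in X - _]scale1r -[X in _ - X]scalerBl -scalerBl.
by congr (_ *: _); ring.
Qed.

(** Once the second term is reordered with [c o'] outside, both terms contain a vanishing
    contraction of [p]; only the commutator at [u = dual o] is left. *)
Lemma harmonic_contraction p : harmonic p ->
  \sum_u osc (sogen_mx F o (dual u)) (p u) = p o'.
Proof.
move=> [ha hc _ _].
have E u : osc (sogen_mx F o (dual u)) (p u) =
    a o (c (dual u) (p u)) - (c o' (a u (p u)) - (u == o')%:R *: p u).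
  by rewrite osc_sogen dualK ca addrK.
rewrite (eq_bigr _ (fun u _ => E u)) !sumrB -!linear_sum ha hc !linear0 /=.
by rewrite sub0r sub0r opprK delta_sum.
Qed.

(** The other coordinates of [p] occur only in contractions, so [p o] and [p o'] suffice. In
    [4 - n], each of the [n] values of [u] contributes -1, two contractions and two diagonal terms
    contribute +1 each. *)
Lemma quadric_op_top p : harmonic p -> quadric_op p o =
  \sum_u osc (sogen_mx F o u) (osc (sogen_mx F o (dual u)) (p o))
  - 2 *: osc (sogen_mx F o o) (p o') + (4 - n%:R) *: p o'.
Proof.
move=> hp; rewrite /quadric_op sum_ffunE.
have E u : tensor_act (sogen F o u) (tensor_act (sogen F o (dual u)) p) o =
    osc (sogen_mx F o u) (osc (sogen_mx F o (dual u)) (p o)) + osc (sogen_mx F o u) (p (dual u))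
    - (u == o)%:R *: osc (sogen_mx F o u) (p o')
    + (osc (sogen_mx F o (dual u)) (p u) + (u == o)%:R *: p (dual u) - p o')
    - (u == o')%:R *: (osc (sogen_mx F o (dual u)) (p o') - p o').
  rewrite tensor_act_sogen eqxx scale1r.
  rewrite [tensor_act _ p o]tensor_act_sogen [tensor_act _ p u]tensor_act_sogen.
  rewrite [tensor_act _ p o']tensor_act_sogen !eqxx !scale1r !dualK.
  rewrite linearB linearD linearZ_LR /= dual_neq scale0r addr0.
  rewrite (eq_sym o u) -(dual_eq o u) (eq_sym o' u).
  by rewrite eqxx scale1r; case: (u == o'); rewrite ?scale1r ?scale0r.
rewrite (eq_bigr _ (fun u _ => E u)) sumrB [X in X - _]big_split /= sumrB.
rewrite [X in X - _ + _]big_split /= sumrB [X in X - \sum_(_ < _) p o']big_split /=.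
have R : \sum_u osc (sogen_mx F o u) (p (dual u)) = p o'.
  rewrite -[RHS](harmonic_contraction hp) (reindex_inj (inv_inj (@dualK l))) /=.
  by apply: eq_bigr => u _; rewrite dualK.
rewrite !delta_sum (harmonic_contraction hp) R sumr_const card_ord.
rewrite scalerBl !scaler_nat mulr2n (mulrnDr _ 2 2) !mulr2n !opprD opprK !addrA dualK.
by rewrite [LHS](+%R).[ACl 1*3*7*2*4*5*8*6].
Qed.

Lemma quadric_op_bot p :
  quadric_op p o' = \sum_u osc (sogen_mx F o u) (osc (sogen_mx F o (dual u)) (p o')).
Proof.
rewrite /quadric_op sum_ffunE.
have E u : tensor_act (sogen F o u) (tensor_act (sogen F o (dual u)) p) o' =
    osc (sogen_mx F o u) (osc (sogen_mx F o (dual u)) (p o'))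
    - (u == o')%:R *: osc (sogen_mx F o u) (p o')
    - (u == o)%:R *: osc (sogen_mx F o (dual u)) (p o').
  rewrite tensor_act_sogen [tensor_act _ p o']tensor_act_sogen !dualK dual_neq !scale0r !addr0.
  rewrite linearB linearZ_LR /= (eq_sym o' u) (inj_eq (inv_inj (@dualK l))) (eq_sym o).
  by case: (u =P o) => [->|_]; rewrite ?scale0r // dual_o !scale0r !subr0.
have z q : osc (sogen_mx F o o') q = 0 by rewrite osc_sogen dualK subrr.
rewrite (eq_bigr _ (fun u _ => E u)) !sumrB !delta_sum.
by rewrite !z !subr0.
Qed.

Variable kappa : {linear P -> F^o}.
Hypothesis kappa_a : forall q, kappa (a o' q) = 0.
Hypothesis kappa_c : forall (i : 'I_l) q, kappa (c (lshift l i) q) = 0.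
Hypothesis kappa_co : forall q, kappa (c o q) = 0.

(* With a_o acting as the derivative in a variable x and c_(dual o) as the derivative in
   a variable y, this is [kappa] applied to (k!)^2 times the coefficient of x^k y^k. *)
Definition coefficient_form (k : nat) (q : P) : F^o :=
  kappa (iter k (a o) (iter k (c o') q)).

Fact iter_linear (f : {linear P -> P}) k : linear (iter k f).
Proof. by elim: k => // k IH x p q; rewrite !iterS IH linearP. Qed.

Fact coefficient_form_linear k : linear (coefficient_form k).
Proof.
by move=> x p q; rewrite /coefficient_form !iter_linear linearP.
Qed.
HB.instance Definition _ k :=
  GRing.isLinear.Build F P F^o _ (coefficient_form k) (coefficient_form_linear k).

(** Of [u] and [dual u] one is in the left block, and its [c] can be brought to the front. *)
Lemma kappa_annihilation_square q : kappa (annihilation_square q) = 0.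
Proof.
rewrite /annihilation_square linear_sum big1 // => u _.
by case: (split_ordP u) => i ->; rewrite dualE ?kappa_c // cC kappa_c.
Qed.

(** Moving [k + 2] copies of [a o] past [annihilation_square] produces [-2 (k + 2)], and [kappa]
    kills the rest; adding the [n - 2] of [osc_quadric] gives [n - 6 - 2 k]. *)
Lemma coefficient_form_quadric k q :
    creation_square q = 0 -> number_op q = (1 - n%:R) *: q ->
  coefficient_form k (\sum_u osc (sogen_mx F o u) (osc (sogen_mx F o (dual u)) q)) =
  (n%:R - 6 - 2 * k%:R) *: coefficient_form k.+1 q.
Proof.
move=> hE hN; rewrite osc_quadric // linearD linearZ_LR /=.
have Fa x : a o (annihilation_square x) = annihilation_square (a o x) - 2 *: c o' x.
  have E u : c u (c (dual u) (a o x)) = a o (c u (c (dual u) x))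
     + (u == o')%:R *: c u x + (u == o)%:R *: c (dual u) x.
    rewrite ca linearD linearZ_LR /= ca addrAC (eq_sym o u) -(dual_eq o u) eq_sym.
    done.
  rewrite /annihilation_square (eq_bigr _ (fun u _ => E u)) !big_split /= !delta_sum.
  by rewrite -linear_sum -addrA -mulr2n scaler_nat addrK.
have Fc x : c o' (annihilation_square x) = annihilation_square (c o' x).
  rewrite /annihilation_square linear_sum; apply: eq_bigr => u _ /=.
  by rewrite cC; congr (c u _); rewrite cC.
have iFc m x : iter m (c o') (annihilation_square x) = annihilation_square (iter m (c o') x).
  by elim: m => //= m ->; rewrite Fc.
have iac m x : c o' (iter m (a o) x) = iter m (a o) (c o' x).
  by elim: m => //= m IH; rewrite c'_a_o IH.
have iFa m x : iter m.+1 (a o) (annihilation_square x) =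
    annihilation_square (iter m.+1 (a o) x) - (2 * m.+1%:R) *: iter m (a o) (c o' x).
  elim: m => [|m IH]; first by rewrite /= Fa mulr1.
  rewrite iterS IH linearB Fa linearZ_LR /= c'_a_o iac -addrA -opprD -scalerDl.
  by congr (_ - _ *: _); rewrite -[m.+2]addn1 natrD; ring.
have ica m x : iter m (c o') (a o x) = a o (iter m (c o') x).
  by elim: m => //= m ->; rewrite c'_a_o.
have E1 : coefficient_form k (a o (a o (annihilation_square q))) =
    - (2 * k.+2%:R) *: coefficient_form k.+1 q.
  rewrite /coefficient_form !ica -!iterSr -[RHS]add0r.
  rewrite iFc iFa linearB linearZ_LR /= kappa_annihilation_square.
  by rewrite scaleNr.
have E2 : coefficient_form k (a o (c o' q)) = coefficient_form k.+1 q.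
  by rewrite /coefficient_form ica -!iterSr.
rewrite E1 E2 -scalerDl; congr (_ *: _).
by rewrite -addn2 natrD; ring.
Qed.

(** The two halves are Euler operators up to normal ordering: the first contributes [-(k + 1)], the
    second [k]. *)
Lemma coefficient_form_cartan k q : coefficient_form k (osc (sogen_mx F o o) q) =
  - (2 * k%:R + 1) *: coefficient_form k q.
Proof.
have coa x : a o (c o x) = c o (a o x) - x by rewrite ca eqxx scale1r addrK.
have icoa m x : iter m.+1 (a o) (c o x) =
    c o (iter m.+1 (a o) x) - m.+1%:R *: iter m (a o) x.
  elim: m => [|m IH]; first by rewrite /= coa scale1r.
  rewrite iterS IH linearB linearZ_LR /= coa -addrA -opprD.
  congr (_ - _); rewrite -[X in X + _]scale1r -scalerDl.
  by rewrite -[m.+2]addn1 natrD addrC.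
have ic'a' m x : iter m (c o') (a o' (c o' x)) =
    a o' (iter m.+1 (c o') x) + m%:R *: iter m (c o') x.
  elim: m => [|m IH]; first by rewrite scale0r addr0.
  rewrite iterS IH linearD linearZ_LR /= ca eqxx scale1r -addrA; congr (_ + _).
  by rewrite -[X in X + _]scale1r -scalerDl -[m.+1]addn1 natrD addrC.
have iac m x : iter m (c o') (a o x) = a o (iter m (c o') x).
  by elim: m => //= m ->; rewrite c'_a_o.
have icc m x : iter m (c o') (c o x) = c o (iter m (c o') x).
  by elim: m => //= m ->; rewrite cC.
have iaa m x : iter m (a o) (a o' x) = a o' (iter m (a o) x).
  by elim: m => //= m ->; rewrite aC.
rewrite osc_sogen linearB /=.
have -> : coefficient_form k (a o (c o q)) = - k.+1%:R *: coefficient_form k q.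
  rewrite /coefficient_form iac icc -iterSr icoa linearB linearZ_LR /= kappa_co.
  by rewrite sub0r scaleNr.
have -> : coefficient_form k (a o' (c o' q)) = k%:R *: coefficient_form k q.
  rewrite /coefficient_form ic'a' addrC iter_linear iaa linearD linearZ_LR /=.
  by rewrite kappa_a addr0.
rewrite -scalerBl; congr (_ *: _); rewrite -addn1 natrD; ring.
Qed.

(** This is phi_k of the overview. The correction is forced: after one application the multiples of
    [coefficient_form k (p o')] add up to [-(k + 1) (n - 6 - 2 k)], the same factor as for [p o]. At
    [k = 0] the truncated predecessor is harmless, being multiplied by 0. *)
Definition quadric_form (k : nat) (p : {ffun 'I_n -> P}) : F^o :=
  coefficient_form k (p o) - k%:R *: coefficient_form k.-1 (p o').

Lemma quadric_form_step k p : harmonic p ->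
  quadric_form k (quadric_op p) = (n%:R - 6 - 2 * k%:R) *: quadric_form k.+1 p.
Proof.
move=> hp; have [_ _ hE hN] := hp.
rewrite /quadric_form quadric_op_bot (quadric_op_top hp) linearD linearB !linearZ_LR /=.
rewrite !coefficient_form_quadric // coefficient_form_cartan /GRing.scale /=.
case: k => [|k] /=; first by ring.
rewrite -[k.+1]addn1 -[(k + 1)%N.+1]addn1 !natrD; ring.
Qed.

Lemma harmonic_comb k p q : harmonic p -> harmonic q -> harmonic (k *: p + q).
Proof.
move=> [ha hc hE hN] [ha' hc' hE' hN']; split=> [||t|t].
- under eq_bigr do rewrite !ffunE linearP.
  by rewrite big_split /= -scaler_sumr ha ha' scaler0 addr0.
- under eq_bigr do rewrite !ffunE linearP.
  by rewrite big_split /= -scaler_sumr hc hc' scaler0 addr0.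
- by rewrite !ffunE creation_square_linear hE hE' scaler0 addr0.
- rewrite !ffunE number_opE linearP /= -!number_opE hN hN'.
  by rewrite scalerDr !scalerA mulrC.
Qed.

Lemma quadric_op_harmonic p : harmonic p -> harmonic (quadric_op p).
Proof.
move=> hp; rewrite /quadric_op; elim/big_rec: _ => [|u q _ hq].
  by rewrite -(addNr p) -scaleN1r; apply: harmonic_comb.
by rewrite -[tensor_act _ _]scale1r; apply: harmonic_comb => //;
  do 2!apply: harmonic_tensor_act.
Qed.

(** The [m + 1] steps pass through the levels k, ..., k + m, and the assumption on [n] makes the
    factor of the last level 0. *)
Lemma quadric_form_iter m k p : n = (2 * (m + k) + 6)%N -> harmonic p ->
  quadric_form k (iter m.+1 quadric_op p) = 0.
Proof.
have hi j q : harmonic q -> harmonic (iter j quadric_op q).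
  by elim: j => //= j IH hq; apply/quadric_op_harmonic/IH.
move=> en hp; elim: m k en => [|m IH] k en.
  rewrite /= quadric_form_step // [in (l + l)%N%:R]en.
  rewrite (_ : _ - _ - _ = 0 :> F) ?scale0r // natrD natrM; ring.
rewrite iterS quadric_form_step ?IH ?scaler0 //; first by rewrite en addSnnS.
exact: hi.
Qed.
End QuadricOperator.
End Oscillator.

(** * A Fock space with a singular vector of weight - alpha_2 *)

Section FockModel.
Variables (F : numFieldType) (l : nat) (hl : (2 < l)%N).
Local Notation n := (l + l)%N.

(** Ordinals count from 0: [idx0], [idx1], [idx2] stand for eps_1, eps_2, eps_3. *)
Definition idx0 : 'I_l := Ordinal (ltnW (ltnW hl)).
Definition idx1 : 'I_l := Ordinal (ltnW hl).
Definition idx2 : 'I_l := Ordinal hl.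

(* A partial Fourier transform of the polynomial representation, exchanging the roles of
   variables and derivatives outside two indices; it makes the vacuum a vector of weight
   - eps_1 - eps_2. *)
Definition special (j : 'I_n) : bool := (j == rshift l idx0) || (j == rshift l idx1).

Definition fock_a (j : 'I_n) (p : {mpoly F[n]}) : {mpoly F[n]} :=
  if special j then 'X_j * p else p^`M(j).
Definition fock_c (j : 'I_n) (p : {mpoly F[n]}) : {mpoly F[n]} :=
  if special j then p^`M(j) else - ('X_j * p).

Fact fock_a_linear j : linear (fock_a j).
Proof.
move=> k p q; rewrite /fock_a; case: (special j); last by rewrite linearP.
by rewrite mulrDr -scalerAr.
Qed.
Fact fock_c_linear j : linear (fock_c j).
Proof.
move=> k p q; rewrite /fock_c; case: (special j); first by rewrite linearP.
by rewrite mulrDr -scalerAr opprD scalerN.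
Qed.
HB.instance Definition _ j := GRing.isLinear.Build F _ _ _ (fock_a j) (fock_a_linear j).
HB.instance Definition _ j := GRing.isLinear.Build F _ _ _ (fock_c j) (fock_c_linear j).

Lemma mderivXU (i j : 'I_n) : 'X_j^`M(i) = (j == i)%:R :> {mpoly F[n]}.
Proof.
rewrite mderivX mnmE; have [->|ji] := eqVneq j i; last by rewrite scale0r.
by rewrite -{1}[U_(i)%MM]addm0 addmC addmK mpolyX0 scale1r.
Qed.

Lemma mderivXM (i j : 'I_n) (p : {mpoly F[n]}) :
  ('X_j * p)^`M(i) = 'X_j * p^`M(i) + (i == j)%:R *: p.
Proof. by rewrite mderivM mderivXU addrC eq_sym mulr_natl scaler_nat. Qed.

Lemma fock_aC i j p : fock_a i (fock_a j p) = fock_a j (fock_a i p).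
Proof.
rewrite /fock_a; case si: (special i); case sj: (special j).
- by rewrite mulrCA.
- have ij : (j == i) = false by apply/eqP => e; rewrite e si in sj.
  by rewrite mderivXM ij scale0r addr0.
- have ij : (i == j) = false by apply/eqP => e; rewrite e sj in si.
  by rewrite mderivXM ij scale0r addr0.
- exact: mderiv_comm.
Qed.

Lemma fock_cC i j p : fock_c i (fock_c j p) = fock_c j (fock_c i p).
Proof.
rewrite /fock_c; case si: (special i); case sj: (special j).
- exact: mderiv_comm.
- have ij : (i == j) = false by apply/eqP => e; rewrite e sj in si.
  by rewrite mderivN mderivXM ij scale0r addr0.
- have ij : (j == i) = false by apply/eqP => e; rewrite e si in sj.
  by rewrite mderivN mderivXM ij scale0r addr0.
- by rewrite !mulrN mulrCA.
Qed.

Lemma fock_ca i j p : fock_c j (fock_a i p) = fock_a i (fock_c j p) + (i == j)%:R *: p.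
Proof.
rewrite /fock_a /fock_c; case sj: (special j); case si: (special i).
- by rewrite mderivXM eq_sym.
- have -> : (i == j) = false by apply/eqP => e; rewrite e sj in si.
  by rewrite scale0r addr0 mderiv_comm.
- have -> : (i == j) = false by apply/eqP => e; rewrite e sj in si.
  by rewrite scale0r addr0 mulrN mulrCA.
- by rewrite mderivN mderivXM opprD addrNK.
Qed.

Definition kappa (p : {mpoly F[n]}) : F^o := p@_(U_(rshift l idx2)).
Fact kappa_linear : linear kappa.
Proof. by move=> k p q; rewrite /kappa mcoeffD mcoeffZ. Qed.
HB.instance Definition _ := GRing.isLinear.Build F _ F^o _ kappa kappa_linear.

Lemma kappaXM (j : 'I_n) p : j != rshift l idx2 -> kappa ('X_j * p) = 0.
Proof.
move=> jn; rewrite /kappa mcoeffM big1 // => -[k1 k2] /= /eqP e.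
rewrite mcoeffX; case: eqP => [e1|_]; last by rewrite mul0r.
move/(congr1 (fun m : 'X_{1..n} => m j)): e.
by rewrite -e1 mnmDE !mnm1E eqxx eq_sym (negPf jn).
Qed.

Definition vac1 : {mpoly F[n]} := 'X_(rshift l idx2).

Lemma below_rshift (j : 'I_n) (k : 'I_l) : rho_check j < rho_check (rshift l k) ->
  exists2 m : 'I_l, j = rshift l m & (m < k)%N.
Proof.
case: (split_ordP j) => m -> h; last first.
  by exists m => //; move: h; rewrite !rho_checkR; lia.
by exfalso; have := ltn_ord m; have := ltn_ord k; move: h; rewrite rho_checkL rho_checkR; lia.
Qed.

(** The special indices are the two lowest ones for [rho_check], and only they lie below
    [rshift l idx2]. *)
Lemma special_below j k : rho_check j < rho_check k ->
  special k || (k == rshift l idx2) -> special j.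
Proof.
move=> jk hk; have [i /= i2 ek] : exists2 i : 'I_l, (i <= 2)%N & k = rshift l i.
  by case/orP: hk => [/orP[]|] /eqP ->; [exists idx0|exists idx1|exists idx2].
move: jk; rewrite ek => /below_rshift[m -> mi].
rewrite /special !(inj_eq (@rshift_inj _ _)).
have : (m < 2)%N by apply: leq_trans mi i2.
by rewrite -!val_eqE /=; case: (nat_of_ord m) => [|[|]].
Qed.

(** One of the two operators multiplies by a variable other than the one [kappa] reads: [fock_a i]
    when [i] is special, and otherwise [fock_c j], which commutes with [fock_a i] because [i] and
    [j] differ. *)
Lemma kappa_lower i j q : rho_check i < rho_check j -> kappa (fock_a i (fock_c j q)) = 0.
Proof.
move=> ij; have [si|si] := boolP (special i).
  rewrite /fock_a si kappaXM //; apply/eqP => e.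
  by move: si; rewrite e /special !(inj_eq (@rshift_inj _ _)) -!val_eqE.
have := contra (special_below ij) si; rewrite negb_or => /andP[sj jn].
have inj : (i == j) = false by apply/eqP => e; rewrite e ltxx in ij.
have := fock_ca i j q; rewrite inj scale0r addr0 => <-.
by rewrite /fock_c (negPf sj) linearN /= kappaXM ?oppr0.
Qed.

(** Mirror image of [kappa_lower]: one of the two operators is a derivative in a variable absent
    from [vac1]. *)
Lemma vac1_raise i j : rho_check j < rho_check i -> fock_a i (fock_c j vac1) = 0.
Proof.
move=> ji; have [sj|sj] := boolP (special j).
  rewrite /fock_c sj mderivXU; case: eqP => [e|_]; last exact: linear0.
  by move: sj; rewrite -e /special !(inj_eq (@rshift_inj _ _)) -!val_eqE.
have := contra (special_below ji) sj; rewrite negb_or => /andP[si ni].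
have inj : (i == j) = false by apply/eqP => e; rewrite e ltxx in ji.
have := fock_ca i j vac1; rewrite inj scale0r addr0 => <-.
by rewrite /fock_a (negPf si) mderivXU eq_sym (negPf ni) linear0.
Qed.

(** Outside the special indices [a_i c_i] is minus the Euler operator minus 1; the two special terms
    compensate this -1. *)
Definition mode_weight (i : 'I_n) : F :=
  (i == rshift l idx0)%:R + (i == rshift l idx1)%:R - (i == rshift l idx2)%:R - 1.

Lemma vac1_weight i : fock_a i (fock_c i vac1) = mode_weight i *: vac1.
Proof.
rewrite /fock_a /fock_c /mode_weight /special; case: ifP => si.
  rewrite mderivXU; case/orP: si => /eqP ->;
  rewrite !(inj_eq (@rshift_inj _ _)) -!val_eqE /= mulr0.
    by rewrite addr0 subr0 subrr scale0r.
  by rewrite add0r subr0 subrr scale0r.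
case/norP: (negbT si) => /negPf -> /negPf ->.
rewrite mderivN mderivXM mderivXU eqxx scale1r addr0 sub0r -opprD scaleNr.
congr (- _); rewrite scalerDl scale1r; congr (_ + _).
by rewrite eq_sym; case: eqP => [->|_]; rewrite ?scale1r ?scale0r ?mulr1 ?mulr0.
Qed.

Local Notation o := (lshift l idx0).
Local Notation P := {mpoly F[n]}.
Definition fock_a_map (j : 'I_n) : {linear P -> P} := fock_a j.
Definition fock_c_map (j : 'I_n) : {linear P -> P} := fock_c j.
Local Notation act := (tensor_act fock_a_map fock_c_map).

Definition highest_vec : {ffun 'I_n -> P} := [ffun t => (t == o)%:R *: vac1].
Definition top_coef (p : {ffun 'I_n -> P}) : F := kappa (p o).

Lemma rho_check_le (i : 'I_n) : rho_check i <= rho_check o.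
Proof.
rewrite rho_checkL /= subr0; case: (split_ordP i) => j ->; have := ltn_ord j;
by rewrite ?rho_checkL ?rho_checkR; lia.
Qed.

Lemma rho_check_ge (i : 'I_n) : rho_check (dual o) <= rho_check i.
Proof. by rewrite rho_check_dual -[rho_check i]opprK lerN2 -rho_check_dual rho_check_le. Qed.

Lemma top_coefP k p q : top_coef (k *: p + q) = k * top_coef p + top_coef q.
Proof. by rewrite /top_coef !ffunE linearP. Qed.

Lemma top_coef_highest : top_coef highest_vec = 1.
Proof. by rewrite /top_coef ffunE eqxx scale1r /kappa mcoeffX eqxx. Qed.

Lemma highest_vec_raise i j : rho_check j < rho_check i -> act (sogen F i j) highest_vec = 0.
Proof.
move=> ji; apply/ffunP => t; rewrite tensor_act_sogen !ffunE.
have -> : (j == o) = false.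
  by apply/negbTE/eqP => e; move: ji; rewrite e ltNge rho_check_le.
have -> : (dual i == o) = false.
  rewrite dual_eq; apply/negbTE/eqP => e; move: ji; rewrite e ltNge.
  by rewrite rho_check_ge.
rewrite !scale0r !scaler0 addr0 subr0 linearZ_LR /= osc_sogen /=.
have ji' : rho_check (dual i) < rho_check (dual j) by rewrite !rho_check_dual ltrN2.
by rewrite !vac1_raise // subr0 scaler0.
Qed.

Lemma top_coef_lower i j p : rho_check i < rho_check j -> top_coef (act (sogen F i j) p) = 0.
Proof.
move=> ij; rewrite /top_coef tensor_act_sogen.
have -> : (o == i) = false.
  by apply/negbTE/eqP => e; move: ij; rewrite -e ltNge rho_check_le.
have -> : (o == dual j) = false.
  rewrite -dual_eq; apply/negbTE/eqP => e; move: ij; rewrite -e ltNge.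
  by rewrite rho_check_ge.
rewrite !scale0r addr0 subr0 osc_sogen linearB /= !kappa_lower ?subr0 //.
by rewrite !rho_check_dual ltrN2.
Qed.

Lemma simple_root2_weight (h : so F l) : weight_at (- simple_root F l 2) h =
  so_mx h (lshift l idx2) (lshift l idx2) - so_mx h (lshift l idx1) (lshift l idx1).
Proof.
rewrite /weight_at /simple_root hl (bigD1 idx2) // (bigD1 idx1) //= big1 => [|i].
  by rewrite !mxE /=; ring.
rewrite -!val_eqE /= => /andP[i2 i1].
by rewrite !mxE !eqSS (negPf i1) (negPf i2) subrr oppr0 mul0r.
Qed.

Lemma highest_vec_weight i :
  act (sogen F i i) highest_vec = weight_at (- simple_root F l 2) (sogen F i i) *: highest_vec.
Proof.
apply/ffunP => t; rewrite tensor_act_sogen simple_root2_weight !ffunE !sogenE.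
have vw j : fock_a_map j (fock_c_map j vac1) = mode_weight j *: vac1 := vac1_weight j.
rewrite linearZ_LR /= osc_sogen !vw -scalerBl !scalerA -scalerDl -scalerBl.
have e j : (t == j)%:R * (j == o)%:R = (t == o)%:R * (j == o)%:R :> F.
  by case: (j =P o) => [->|_]; rewrite ?mulr0.
have r (k : 'I_l) : (dual i == rshift l k) = (i == lshift l k) by rewrite dual_eq dualR.
have r' (k : 'I_l) : (dual i == lshift l k) = (i == rshift l k) by rewrite dual_eq dualL.
rewrite !e !andbb !(eq_sym (lshift l _)) /mode_weight !r !r'.
by congr (_ *: _); ring.
Qed.

Lemma vac1_a_lshift (k : 'I_l) : fock_a (lshift l k) vac1 = 0.
Proof. by rewrite /fock_a /special !eq_lrshift mderivXU eq_rlshift. Qed.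

Lemma highest_vec_harmonic : harmonic fock_a_map fock_c_map highest_vec.
Proof.
have cs0 : creation_square fock_a_map vac1 = 0.
  rewrite /creation_square big1 // => u _; case: (split_ordP u) => k ->.
    by rewrite dualL [LHS]fock_aC [fock_a _ vac1]vac1_a_lshift linear0.
  by rewrite dualR [fock_a_map _ vac1]vac1_a_lshift linear0.
(* The mode weights add up to 1 + 1 - 1 - n, which is the origin of the eigenvalue in [harmonic]. *)
have nv : number_op fock_a_map fock_c_map vac1 = (1 - n%:R) *: vac1.
  have vw j : fock_a_map j (fock_c_map j vac1) = mode_weight j *: vac1 := vac1_weight j.
  rewrite /number_op (eq_bigr _ (fun u _ => vw u)).
  rewrite -scaler_suml; congr (_ *: _); rewrite /mode_weight.
  rewrite sumrB sumrB big_split /= sumr_const card_ord.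
  have d (j : 'I_n) : \sum_(i < n) (i == j)%:R = 1 :> F.
    by rewrite (bigD1 j) //= eqxx big1 ?addr0 // => i /negPf ->.
  by rewrite !d; ring.
split=> [||t|t].
- under eq_bigr do rewrite ffunE linearZ_LR.
  by rewrite delta_sum [LHS]vac1_a_lshift.
- under eq_bigr do rewrite ffunE linearZ_LR.
  rewrite delta_sum dualL /fock_c_map /= /fock_c /special eqxx /=.
  by rewrite mderivXU (inj_eq (@rshift_inj _ _)) -val_eqE.
- rewrite ffunE -[_ *: vac1]addr0 creation_square_linear cs0 scaler0 add0r.
  have := creation_square_linear fock_a_map (-1) 0 0.
  by rewrite scaler0 addr0 scaleN1r addNr.
- by rewrite ffunE number_opE [LHS]linearZ_LR /= -number_opE nv !scalerA mulrC.
Qed.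

End FockModel.

(** * Highest-weight vectors of the symmetric square *)

Section SymmetricSquareCoefficients.
Variables (F : numFieldType) (l : nat).
Local Notation n := (l + l)%N.
Local Notation g := (so F l).
Implicit Types (q r : 'I_n * 'I_n) (w : sym2 g).

Definition entry (x : g) q : F := so_mx x q.1 q.2.
Definition sogen_pair q : g := sogen F q.1 q.2.

Lemma entryP k x y q : entry (k *: x + y) q = k * entry x q + entry y q.
Proof. by rewrite /entry so_mx_lin !mxE. Qed.

Lemma so_decomp_pair x : x = \sum_q (2^-1 * entry x q) *: sogen_pair q.
Proof.
rewrite -(pair_bigA _ (fun i j => (2^-1 * so_mx x i j) *: sogen F i j)) /=.
rewrite {1}[x]so_decomp scaler_sumr; apply: eq_bigr => i _.
by rewrite scaler_sumr; apply: eq_bigr => j _; rewrite scalerA.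
Qed.

(** The value at [w] of a symmetric bilinear test form, so that equalities in S^2(g) become
    equalities of scalars. *)
Definition sym_coef w q r : F :=
  \sum_(p <- w) (entry p.1 q * entry p.2 r + entry p.1 r * entry p.2 q).

Lemma sym_coefC w q r : sym_coef w q r = sym_coef w r q.
Proof. by apply: eq_bigr => p _; rewrite addrC. Qed.

Lemma entry_form_symmetric q r : symmetric_bilinear
  (fun x y => entry x q * entry y r + entry x r * entry y q : F^o).
Proof.
split=> [a x y z|x y]; last by rewrite addrC [entry x r * _]mulrC [entry x q * _]mulrC.
by rewrite !entryP /GRing.scale /=; ring.
Qed.

Section Expansion.
Variables (W : lmodType F) (b : g -> g -> W).
Hypothesis hb : symmetric_bilinear b.

Lemma bilinear_suml (I : finType) (c : I -> F) (x : I -> g) y :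
  b (\sum_i c i *: x i) y = \sum_i c i *: b (x i) y.
Proof.
have [bl _] := hb.
have b0 : b 0 y = 0.
  by have := bl (-1) 0 0 y; rewrite scaler0 addr0 scaleN1r addNr.
elim: (index_enum I) => [|i s IH]; first by rewrite !big_nil.
by rewrite !big_cons bl IH.
Qed.

(** In 1/8, two factors 1/2 come from [so_decomp] in each argument and the third from the two terms
    of [sym_coef]. *)
Lemma sym2_expand w : \sum_(p <- w) b p.1 p.2 =
  8^-1 *: \sum_q \sum_r sym_coef w q r *: b (sogen_pair q) (sogen_pair r).
Proof.
have [_ bs] := hb.
have E (x y : g) : b x y = 4^-1 *: \sum_q \sum_r (entry x q * entry y r) *: b (sogen_pair q) (sogen_pair r).
  rewrite {1}[x]so_decomp_pair bilinear_suml scaler_sumr; apply: eq_bigr => q _.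
  rewrite bs {1}[y]so_decomp_pair bilinear_suml !scaler_sumr; apply: eq_bigr => r _.
  by rewrite !scalerA bs; congr (_ *: _); field.
have E2 (x y : g) : b x y = 8^-1 *: \sum_q \sum_r
    (entry x q * entry y r + entry x r * entry y q) *: b (sogen_pair q) (sogen_pair r).
  have -> : 8^-1 = 2^-1 * 4^-1 :> F by field.
  rewrite -scalerA.
  under eq_bigr do under eq_bigr do rewrite scalerDl.
  under eq_bigr do rewrite big_split.
  rewrite big_split /= scalerDr -E [X in _ + _ *: X]exchange_big /=.
  under [X in _ + _ *: X]eq_bigr do under eq_bigr do rewrite bs.
  rewrite -E -mulr2n -scaler_nat scalerA mulVf ?scale1r //.
  by rewrite pnatr_eq0.
under eq_bigr do rewrite E2.
rewrite -scaler_sumr; congr (_ *: _).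
rewrite exchange_big; apply: eq_bigr => q _ /=.
rewrite exchange_big; apply: eq_bigr => r _ /=.
by rewrite -scaler_suml.
Qed.
End Expansion.

Lemma sym_coef_weight w mu h q r : cartan h ->
    sym2_eq (sym2_ad h w) (sym2_scale (weight_at mu h) w) ->
  (so_mx h q.1 q.1 - so_mx h q.2 q.2 + (so_mx h r.1 r.1 - so_mx h r.2 r.2)
    - weight_at mu h) * sym_coef w q r = 0.
Proof.
move=> ch /(_ _ _ (entry_form_symmetric q r)).
rewrite big_cat !big_map /= -big_split /= => e.
have lE x s : entry (lie h x) s = (so_mx h s.1 s.1 - so_mx h s.2 s.2) * entry x s.
  exact: cartan_lie.
rewrite mulrBl; apply/eqP; rewrite subr_eq0; apply/eqP.
rewrite /sym_coef !mulr_sumr; apply: etrans (etrans e _); apply: eq_bigr => p _.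
  by rewrite !lE; ring.
by rewrite -[weight_at mu h *: _]addr0 !entryP -/(entry _ _) /entry !mxE; ring.
Qed.

Lemma sym_coef_raise w e q r : sym2_eq (sym2_ad e w) [::] ->
  \sum_(p <- w) (entry (lie e p.1) q * entry p.2 r + entry (lie e p.1) r * entry p.2 q
    + (entry p.1 q * entry (lie e p.2) r + entry p.1 r * entry (lie e p.2) q)) = 0.
Proof.
move=> /(_ _ _ (entry_form_symmetric q r)).
by rewrite big_cat !big_map /= -big_split /= big_nil.
Qed.

Lemma entry_lie_sogen i j x s t : entry (lie (sogen F i j) x) (s, t) =
  (s == i)%:R * so_mx x j t - (s == dual j)%:R * so_mx x (dual i) t
  - ((t == j)%:R * so_mx x s i - (t == dual i)%:R * so_mx x s (dual j)).
Proof.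
have dl a b (A : 'M[F]_n) : (delta_mx a b *m A) s t = (s == a)%:R * A b t.
  rewrite mxE (bigD1 b) //= big1 ?addr0 => [|k kb]; first by rewrite mxE eqxx andbT.
  by rewrite mxE (negPf kb) andbF mul0r.
have dr a b (A : 'M[F]_n) : (A *m delta_mx a b) s t = (t == b)%:R * A s a.
  rewrite mxE (bigD1 a) //= big1 ?addr0 => [|k kb]; first by rewrite mxE eqxx mulrC.
  by rewrite mxE (negPf kb) mulr0.
rewrite /entry /= /sogen_mx mulmxBl mulmxBr.
have mB (A B : 'M[F]_n) : (A - B) s t = A s t - B s t by rewrite !mxE.
by rewrite !mB !dl !dr.
Qed.

End SymmetricSquareCoefficients.

(** * Positive roots of type D in coordinates *)

Section PositiveRoots.
Variables (F : numFieldType) (l : nat).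
Local Notation n := (l + l)%N.
Local Notation g := (so F l).

Definition index_weight (i : 'I_n) : 'rV[F]_l :=
  match split i with inl k => eps F l k.+1 | inr k => - eps F l k.+1 end.

Lemma index_weightL (k : 'I_l) : index_weight (lshift l k) = eps F l k.+1.
Proof. by rewrite /index_weight (unsplitK (inl k)). Qed.

Lemma index_weightR (k : 'I_l) : index_weight (rshift l k) = - eps F l k.+1.
Proof. by rewrite /index_weight (unsplitK (inr k)). Qed.

Lemma weight_atB mu nu (h : g) : weight_at (mu - nu) h = weight_at mu h - weight_at nu h.
Proof. by rewrite /weight_at -sumrB; apply: eq_bigr => k _; rewrite !mxE mulrBl. Qed.

Lemma weight_at_eps (k : 'I_l) (h : g) :
  weight_at (eps F l k.+1) h = so_mx h (lshift l k) (lshift l k).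
Proof.
rewrite /weight_at (bigD1 k) //= big1 => [|i ik]; first by rewrite !mxE eqxx mul1r addr0.
by rewrite mxE eqSS (_ : (i : nat) == k = false) ?mul0r //; apply/negbTE.
Qed.

Lemma weight_at_index i (h : g) : weight_at (index_weight i) h = so_mx h i i.
Proof.
case: (split_ordP i) => k ->; first by rewrite index_weightL weight_at_eps.
rewrite index_weightR so_dual dualR -weight_at_eps -[- eps _ _ _]add0r weight_atB.
rewrite [weight_at 0 h]big1 ?sub0r // => j _.
by rewrite mxE mul0r.
Qed.

Definition nonneg_root_sum (mu : 'rV[F]_l) : Prop :=
  exists c : nat -> nat, mu = \sum_(1 <= i < l.+1) simple_root F l i *+ c i.

Lemma nonneg_root_sumD mu nu :
  nonneg_root_sum mu -> nonneg_root_sum nu -> nonneg_root_sum (mu + nu).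
Proof.
move=> [c ->] [d ->]; exists (fun i => (c i + d i)%N); rewrite -big_split.
by apply: eq_bigr => i _; rewrite mulrnDr.
Qed.

Lemma nonneg_root_sum_simple i : (0 < i <= l)%N -> nonneg_root_sum (simple_root F l i).
Proof.
move=> /andP[i0 il]; exists (fun j => (j == i) : nat).
rewrite (bigD1_seq i) ?mem_index_iota ?i0 ?ltnS ?iota_uniq //= eqxx mulr1n.
by rewrite big1 ?addr0 // => j /negPf ->.
Qed.

Lemma nonneg_root_sum_eps a b : (0 < a <= b)%N -> (b <= l)%N ->
  nonneg_root_sum (eps F l a - eps F l b).
Proof.
move=> /andP[a0]; elim: b => [|b IH]; first by rewrite leqn0 => /eqP e; rewrite e in a0.
rewrite leq_eqVlt => /orP[/eqP <- _|ab bl].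
  by rewrite subrr; exists (fun=> 0%N); rewrite big1.
rewrite -(subrKA (eps F l b)); apply: nonneg_root_sumD; first by apply: IH => //; apply: ltnW.
have := @nonneg_root_sum_simple b; rewrite /simple_root bl; apply.
by rewrite (leq_trans a0) //= ltnW.
Qed.

Lemma sogen_root_vector i j : root_vector (index_weight i - index_weight j) (sogen F i j).
Proof.
by move=> h ch; rewrite cartan_lie_sogen // weight_atB !weight_at_index.
Qed.

Lemma sogen_positive_root i j : rho_check j < rho_check i -> j != dual i ->
  positive_root (index_weight i - index_weight j).
Proof.
move=> ji jn; split.
- move=> e; have := weight_atB (index_weight i) (index_weight j) (rho_check_elt F l).
  rewrite e !weight_at_index !rho_check_eltE /weight_at big1 => [/esym/eqP|k _].
    by rewrite subr_eq0 eqr_int => /eqP e'; rewrite e' ltxx in ji.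
  by rewrite mxE mul0r.
- exists (sogen F i j); last exact: sogen_root_vector.
  move=> /(congr1 (fun x : g => so_mx x i j)); rewrite sogenE !eqxx /= mxE.
  by rewrite -dual_eq eq_sym (negPf jn) subr0 => /eqP; rewrite oner_eq0.
(* For eps_a + eps_b with a < b, the decomposition is (eps_a - eps_(l-1)) + alpha_l + (eps_b -
   eps_l). *)
suff LR (a b : 'I_l) : (a < b)%N -> nonneg_root_sum (eps F l a.+1 + eps F l b.+1).
  case: (split_ordP i) ji jn => a ->; case: (split_ordP j) => b ->;
    rewrite ?rho_checkL ?rho_checkR ?dualL ?dualR ?index_weightL ?index_weightR => ji jn.
  - by apply: nonneg_root_sum_eps => //; move: ji; lia.
  - rewrite opprK; have [ab|ba|/val_inj ab] := ltngtP a b; first exact: LR.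
      by rewrite addrC; apply: LR.
    by rewrite ab eqxx in jn.
  - by exfalso; have := ltn_ord a; have := ltn_ord b; move: ji; lia.
  - by rewrite opprK addrC; apply: nonneg_root_sum_eps => //; move: ji; lia.
move=> ab; have bl := ltn_ord b.
have -> : eps F l a.+1 + eps F l b.+1 = (eps F l a.+1 - eps F l l.-1)
    + (simple_root F l l + (eps F l b.+1 - eps F l l)).
  by rewrite /simple_root ltnn addrA subrKA addrACA subrr addr0.
apply: nonneg_root_sumD; first by apply: nonneg_root_sum_eps; lia.
apply: nonneg_root_sumD; last by apply: nonneg_root_sum_eps; lia.
by apply: nonneg_root_sum_simple; lia.
Qed.

End PositiveRoots.

Section HighestWeightSquares.
Variables (F : numFieldType) (l : nat) (w : sym2 (so F l)).
Local Notation n := (l + l)%N.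
Local Notation g := (so F l).
Implicit Types (q r : 'I_n * 'I_n).
Local Notation T := (sym_coef w).

Definition reflect_pair q : 'I_n * 'I_n := (dual q.2, dual q.1).

Lemma reflect_pairK : involutive reflect_pair.
Proof. by case=> i j; rewrite /reflect_pair /= !dualK. Qed.

Lemma entry_reflect (x : g) q : entry x (reflect_pair q) = - entry x q.
Proof. by rewrite /entry so_dual !dualK. Qed.

Lemma sogen_pair_reflect q : sogen_pair F (reflect_pair q) = - sogen_pair F q.
Proof. exact: sogen_dual. Qed.

Lemma sym_coef_reflect q r : T (reflect_pair q) r = - T q r.
Proof.
rewrite /sym_coef -sumrN; apply: eq_bigr => p _.
by rewrite !entry_reflect; ring.
Qed.

Lemma bilinearNl (W : lmodType F) (b : g -> g -> W) x y :
  symmetric_bilinear b -> b (- x) y = - b x y.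
Proof.
move=> [bl _]; have b0 : b 0 y = 0.
  by have := bl (-1) 0 0 y; rewrite scaler0 addr0 scaleN1r addNr.
by have := bl (-1) x 0 y; rewrite b0 !addr0 !scaleN1r.
Qed.

(* The pairs with first entry [o] and their reflections [(_, dual o)] exhaust the support. *)
Lemma sum_reflect (W : lmodType F) (o : 'I_n) (f : 'I_n * 'I_n -> W) :
    (forall q, f (reflect_pair q) = f q) ->
    (forall q, f q != 0 -> (q.1 == o) (+) (q.2 == dual o)) ->
  \sum_q f q = 2 *: \sum_u f (o, u).
Proof.
move=> fr fs.
have E q : f q = (q.1 == o)%:R *: f q + (q.2 == dual o)%:R *: f q.
  have [->|/fs] := eqVneq (f q) 0; first by rewrite !scaler0 addr0.
  by case: (q.1 == o); case: (q.2 == dual o); rewrite //= scale1r scale0r ?addr0 ?add0r.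
have S : \sum_q (q.1 == o)%:R *: f q = \sum_u f (o, u).
  have -> : \sum_q (q.1 == o)%:R *: f q = \sum_i \sum_j (i == o)%:R *: f (i, j).
    by rewrite pair_bigA; apply: eq_bigr => -[].
  by under eq_bigr do rewrite -scaler_sumr; rewrite delta_sum.
rewrite (eq_bigr _ (fun q _ => E q)) big_split /= S scaler_nat mulr2n; congr (_ + _).
rewrite (reindex_inj (inv_inj reflect_pairK)) -S; apply: eq_bigr => q _ /=.
by rewrite fr (inj_eq (inv_inj (@dualK l))).
Qed.

Lemma sogen_diag (i s : 'I_n) : so_mx (sogen F i i) s s = (s == i)%:R - (s == dual i)%:R.
Proof. by rewrite sogenE !andbb. Qed.

(** The eps_1-degree 2 is shared by two root vectors of degree at most 1 each, so both attain 1. The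
    unreduced [true%:R - false%:R] is the shape left by [sogen_diag] at [o]. *)
Lemma degree_one (x1 x2 y1 y2 z1 z2 t1 t2 : bool) :
    x1 && x2 = false -> y1 && y2 = false -> z1 && z2 = false -> t1 && t2 = false ->
    x1 && y2 = false -> z1 && t2 = false ->
    (x1%:R - x2%:R - (y1%:R - y2%:R) + (z1%:R - z2%:R - (t1%:R - t2%:R))
      - 2 * (true%:R - false%:R) == 0 :> F) -> x1 (+) y2.
Proof.
have <- : (x1 + y2 + z1 + t2)%N%:R - (2 + x2 + y1 + z2 + t1)%N%:R = x1%:R - x2%:R
    - (y1%:R - y2%:R) + (z1%:R - z2%:R - (t1%:R - t2%:R)) - 2 * (true%:R - false%:R) :> F.
  by rewrite subr0 mulr1 !natrD; ring.
rewrite subr_eq0 eqr_nat.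
by case: x1; case: x2; case: y1; case: y2; case: z1; case: z2; case: t1; case: t2.
Qed.

(** * The vector of weight 2 eps_1 *)

Section Quadric.
Hypothesis hl : (2 < l)%N.
Hypothesis hw : is_highest_weight_sym2 (eps F l 1 *+ 2) w.
Local Notation o := (lshift l (idx0 hl)).

Lemma quadric_weight h q r : cartan h ->
  (so_mx h q.1 q.1 - so_mx h q.2 q.2 + (so_mx h r.1 r.1 - so_mx h r.2 r.2)
    - 2 * so_mx h o o) * T q r = 0.
Proof.
move=> ch; have [_ _ /(_ h ch)/(sym_coef_weight q r ch)] := hw.
have -> : weight_at (eps F l 1 *+ 2) h = 2 * so_mx h o o; last by [].
rewrite -(@weight_at_eps F l (idx0 hl)) /weight_at mulr_sumr.
by apply: eq_bigr => k _; rewrite mulr2n !mxE; ring.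
Qed.

Lemma quadric_raise (i j : 'I_l) q r : (i < j)%N ->
  \sum_(p <- w) (entry (lie (sogen F (lshift l i) (lshift l j)) p.1) q * entry p.2 r
    + entry (lie (sogen F (lshift l i) (lshift l j)) p.1) r * entry p.2 q
    + (entry p.1 q * entry (lie (sogen F (lshift l i) (lshift l j)) p.2) r
    + entry p.1 r * entry (lie (sogen F (lshift l i) (lshift l j)) p.2) q)) = 0.
Proof.
move=> ij; apply: sym_coef_raise; have [_ hr _] := hw.
apply: (hr _ _ _ (@sogen_root_vector F l (lshift l i) (lshift l j))); apply: sogen_positive_root.
  by rewrite !rho_checkL; lia.
by rewrite dualL eq_lrshift.
Qed.

Lemma quadric_support q r : T q r != 0 -> (q.1 == o) (+) (q.2 == dual o).
Proof.
move=> T0; have := quadric_weight q r (sogen_cartan F o).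
rewrite !sogen_diag => /eqP; rewrite mulf_eq0 (negPf T0) orbF.
have e s : (s == o) && (s == dual o) = false.
  by apply/negP => /andP[/eqP -> ]; rewrite eq_sym dual_neq.
have nz s t : T s t != 0 -> (s.1 == o) && (s.2 == dual o) = false.
  case: s => s1 s2 st; apply/negP => /andP[/eqP /= e1 /eqP /= e2]; case/eqP: st.
  have := sym_coef_reflect (o, dual o) t; rewrite /reflect_pair /= dualK e1 e2.
  by move/eqP; rewrite -addr_eq0 -mulr2n -mulr_natl mulf_eq0 pnatr_eq0 /= => /eqP.
have := nz _ _ T0; have := nz r q; rewrite sym_coefC => /(_ T0).
have := e q.1; have := e q.2; have := e r.1; have := e r.2.
rewrite eqxx (eq_sym o) dual_neq.
by move=> h1 h2 h3 h4 h5 h6; apply: degree_one h4 h3 h2 h1 h6 h5.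
Qed.

(** Beyond [2 eps_1] no weight remains, so those of the columns [u] and [v] must cancel; test with
    the Cartan element of [u]. *)
Lemma quadric_coef_row u v : T (o, u) (o, v) != 0 -> v = dual u.
Proof.
move=> T0; apply/eqP/negPn/negP => vu.
have := quadric_weight (o, u) (o, v) (sogen_cartan F u).
rewrite !sogen_diag /= eqxx [u == dual u]eq_sym dual_neq (negPf vu) !subr0.
move/eqP; rewrite mulf_eq0 (negPf T0) orbF.
rewrite [X in X == 0](_ : _ = - (1 + (v == u))%N%:R); last by rewrite natrD /=; ring.
by rewrite oppr_eq0 pnatr_eq0.
Qed.

(* Invariance under the root vector of eps_i - eps_j. *)
Lemma quadric_coef_const (i j : 'I_l) : (0 < i)%N -> (i < j)%N ->
  T (o, lshift l i) (o, rshift l i) = T (o, lshift l j) (o, rshift l j).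
Proof.
move=> i0 ij; have := quadric_raise (o, lshift l j) (o, rshift l i) ij.
have oi : (idx0 hl == i) = false by apply/negbTE; rewrite -val_eqE /= neq_ltn i0.
have ji : (j == i) = false by apply/negbTE; rewrite -val_eqE /= neq_ltn ij orbT.
have E1 x : entry (lie (sogen F (lshift l i) (lshift l j)) x) (o, lshift l j) =
    - so_mx x o (lshift l i).
  rewrite entry_lie_sogen !dualL eq_lshift oi !eq_lrshift eqxx !mul0r subrr sub0r.
  by rewrite mul1r subr0.
have E2 x : entry (lie (sogen F (lshift l i) (lshift l j)) x) (o, rshift l i) =
    so_mx x o (rshift l j).
  rewrite entry_lie_sogen !dualL eq_lshift oi eq_lrshift eq_rlshift eqxx !mul0r subrr.
  by rewrite mul1r !sub0r opprK.
move=> e; apply/eqP; rewrite eq_sym -subr_eq0 -[X in _ == X]e /sym_coef -sumrB.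
by apply/eqP/eq_bigr => p _; rewrite !E1 !E2 /entry /=; ring.
Qed.

Lemma quadric_sym2 : exists c : F, forall (W : lmodType F) (b : g -> g -> W),
  symmetric_bilinear b ->
  \sum_(p <- w) b p.1 p.2 = c *: \sum_u b (sogen F o u) (sogen F o (dual u)).
Proof.
pose c := T (o, lshift l (idx1 hl)) (o, rshift l (idx1 hl)).
(* The 1/2 is the 1/8 of [sym2_expand] times a factor 2 from [sum_reflect] for each of the two
   pairs. *)
exists (2^-1 * c) => W b hb; rewrite (sym2_expand hb).
have [_ bs] := hb.
have br x y : b x (- y) = - b x y by rewrite bs bilinearNl // bs.
pose f q := \sum_r T q r *: b (sogen_pair F q) (sogen_pair F r).
rewrite (@sum_reflect _ o f) => [|q|q f0]; last first.
- have [r] : exists r, T q r != 0; last exact: quadric_support.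
  apply: contrapT => nex; case/eqP: f0; rewrite /f big1 // => r _.
  have [->|T0] := eqVneq (T q r) 0; first by rewrite scale0r.
  by case: nex; exists r.
- apply: eq_bigr => r _; rewrite sym_coef_reflect sogen_pair_reflect bilinearNl //.
  by rewrite scaleNr scalerN opprK.
have fE u : f (o, u) = 2 *: (c *: b (sogen F o u) (sogen F o (dual u))).
  rewrite /f (@sum_reflect _ o) => [|r|r]; last first.
  - move=> fr; have : T r (o, u) != 0; last exact: quadric_support.
    by apply/eqP => T0; move: fr; rewrite sym_coefC T0 scale0r eqxx.
  - rewrite sym_coefC sym_coef_reflect sym_coefC sogen_pair_reflect br.
    by rewrite scaleNr scalerN opprK.
  congr (_ *: _); rewrite (bigD1 (dual u)) //= big1 ?addr0 => [|v vu]; last first.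
    have [->|/quadric_coef_row e] := eqVneq (T (o, u) (o, v)) 0; first by rewrite scale0r.
    by rewrite e eqxx in vu.
  rewrite /sogen_pair /=.
  have b0 x : b x 0 = 0 by have := br x 0; rewrite oppr0 => /opp_eq0.
  have Go0 : sogen F o (dual o) = 0 by apply/val_inj; rewrite /= /sogen_mx dualK subrr.
  have Tl (i : 'I_l) : (0 < i)%N -> T (o, lshift l i) (o, rshift l i) = c.
    rewrite leq_eqVlt => /orP[/eqP i1|i1].
      by rewrite /c (_ : idx1 hl = i) //; apply/val_inj.
    by rewrite /c; apply/esym/quadric_coef_const.
  (* At the index of eps_1 the coefficient need not be [c], but there one factor is
     [sogen o (dual o)], which is 0. *)
  case: (split_ordP u) => i ->; rewrite ?dualL ?dualR.
    have [i0|i0] := posnP i; last by rewrite Tl.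
    have -> : i = idx0 hl by apply/val_inj.
    by rewrite -dualL Go0 b0 !scaler0.
  have [i0|i0] := posnP i; last by rewrite sym_coefC Tl.
  have -> : i = idx0 hl by apply/val_inj.
  by rewrite -dualL Go0 bs b0 !scaler0.
rewrite (eq_bigr _ (fun u _ => fE u)) -!scaler_sumr !scalerA.
by congr (_ *: _); field.
Qed.

End Quadric.

(** * The vector of weight eps_1 + eps_2 + eps_3 + eps_4 *)

Section PfaffianSquare.
Hypothesis hl : (4 <= l)%N.
Hypothesis hw : is_highest_weight_sym2
  (eps F l 1 + eps F l 2 + eps F l 3 + eps F l 4) w.

Definition pfaffian_coef (i j k m : 'I_l) : F :=
  T (lshift l i, rshift l j) (lshift l k, rshift l m).
Local Notation tau := pfaffian_coef.

Lemma pfaffian_weight_at (h : g) :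
  weight_at (eps F l 1 + eps F l 2 + eps F l 3 + eps F l 4) h =
  \sum_(k < l | (k < 4)%N) so_mx h (lshift l k) (lshift l k).
Proof.
rewrite /weight_at [RHS]big_mkcond; apply: eq_bigr => k _.
rewrite !mxE !eqSS -!natrD.
by case: (nat_of_ord k) => [|[|[|[|j]]]] /=; rewrite ?mul1r ?mul0r.
Qed.

Lemma pfaffian_weight h q r : cartan h ->
  (so_mx h q.1 q.1 - so_mx h q.2 q.2 + (so_mx h r.1 r.1 - so_mx h r.2 r.2)
    - \sum_(k < l | (k < 4)%N) so_mx h (lshift l k) (lshift l k)) * T q r = 0.
Proof.
by move=> ch; have [_ _ /(_ h ch)/(sym_coef_weight q r ch)] := hw; rewrite pfaffian_weight_at.
Qed.

Definition low_left (s : 'I_n) : bool :=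
  match split s with inl i => (i < 4)%N | inr _ => false end.
Definition low_right (s : 'I_n) : bool :=
  match split s with inl _ => false | inr i => (i < 4)%N end.

Lemma low_leftP s : low_left s -> exists i, s = lshift l i.
Proof.
by rewrite /low_left; case: (split_ordP s) => i -> //; exists i.
Qed.

Lemma low_rightP s : low_right s -> exists i, s = rshift l i.
Proof.
by rewrite /low_right; case: (split_ordP s) => i -> //; exists i.
Qed.

(** A coweight with eigenvalues 1, 0, -1 on C^(2l), taking the value 4 on the weight of [w]. *)
Definition grading_elt : g := \sum_(k < l | (k < 4)%N) sogen F (lshift l k) (lshift l k).

Lemma grading_elt_cartan : cartan grading_elt.
Proof.
apply/cartanP => p q pq; rewrite /grading_elt so_mx_sum summxE big1 // => k _.
by have /cartanP/(_ _ _ pq) := sogen_cartan F (lshift l k).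
Qed.

Lemma sum_low (i : 'I_l) : \sum_(k < l | (k < 4)%N) (i == k)%:R = (i < 4)%N%:R :> F.
Proof.
case: (boolP (i < 4)%N) => i4; last first.
  by rewrite big1 // => k k4; case: eqP => // e; rewrite e k4 in i4.
by rewrite (bigD1 i) //= eqxx big1 ?addr0 // => k /andP[_ /negPf]; rewrite eq_sym => ->.
Qed.

Lemma grading_eltE s :
  so_mx grading_elt s s = (low_left s)%:R - (low_right s)%:R.
Proof.
rewrite /grading_elt so_mx_sum summxE; under eq_bigr do rewrite sogen_diag dualL.
rewrite sumrB /low_left /low_right; case: (split_ordP s) => i ->.
  under eq_bigr do rewrite eq_lshift.
  by rewrite sum_low big1 // => k _; rewrite eq_lrshift.
under [X in _ - X]eq_bigr do rewrite eq_rshift.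
by rewrite sum_low big1 // => k _; rewrite eq_rlshift.
Qed.

(** Each of the four matrix indices contributes at most 1, so a total of 4 makes all of them
    extremal. *)
Lemma degree_two (x1 x2 y1 y2 z1 z2 t1 t2 : bool) :
    (x1%:R - x2%:R - (y1%:R - y2%:R) + (z1%:R - z2%:R - (t1%:R - t2%:R)) - 4 == 0 :> F) ->
  [&& x1, y2, z1 & t2].
Proof.
have <- : (x1 + y2 + z1 + t2)%N%:R - (4 + x2 + y1 + z2 + t1)%N%:R = x1%:R - x2%:R
    - (y1%:R - y2%:R) + (z1%:R - z2%:R - (t1%:R - t2%:R)) - 4 :> F.
  by rewrite !natrD; ring.
rewrite subr_eq0 eqr_nat.
by case: x1; case: x2; case: y1; case: y2; case: z1; case: z2; case: t1; case: t2.
Qed.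

Lemma pfaffian_support q r : T q r != 0 ->
  [&& low_left q.1, low_right q.2, low_left r.1 & low_right r.2].
Proof.
move=> T0; have := pfaffian_weight q r grading_elt_cartan.
move/eqP; rewrite mulf_eq0 (negPf T0) orbF.
rewrite !grading_eltE [\sum_(k < l | _) _](_ : _ = 4); first exact: degree_two.
pose o4 (k : 'I_4) : 'I_l := widen_ord hl k.
transitivity (\sum_(k < l | (k < 4)%N) (1 : F)).
  apply: eq_bigr => k k4; rewrite grading_eltE /low_left /low_right (unsplitK (inl k)).
  by rewrite k4 subr0.
rewrite sumr_const; congr (_ *+ _).
rewrite -[RHS](card_ord 4) -(card_image (f := o4)); last first.
  by move=> a b /(congr1 val) /= /val_inj.
apply: eq_card => k; apply/idP/imageP => [k4|[a _ ->]]; last exact: (ltn_ord a).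
by exists (Ordinal (k4 : (k < 4)%N)) => //; apply/val_inj.
Qed.

(** No coordinate of the weight of [w] exceeds 1. *)
Lemma pfaffian_coef_distinct i j k m s : tau i j k m != 0 ->
  ((i == s) + (j == s) + (k == s) + (m == s) <= 1)%N.
Proof.
move=> T0; have := pfaffian_weight (lshift l i, rshift l j) (lshift l k, rshift l m)
  (sogen_cartan F (lshift l s)).
move/eqP; rewrite mulf_eq0 -/(tau _ _ _ _) (negPf T0) orbF.
under [\sum_(_ < l | _) _]eq_bigr do rewrite sogen_diag dualL eq_lrshift subr0 eq_lshift eq_sym.
rewrite sum_low !sogen_diag !dualL /= !eq_lshift !eq_rshift !eq_lrshift !eq_rlshift.
have -> : (i == s)%:R - false%:R - (false%:R - (j == s)%:R)
    + ((k == s)%:R - false%:R - (false%:R - (m == s)%:R)) - (s < 4)%N%:R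
    = ((i == s) + (j == s) + (k == s) + (m == s))%N%:R - (s < 4)%N%:R :> F.
  by rewrite !natrD /=; ring.
by rewrite subr_eq0 eqr_nat => /eqP ->; case: (s < 4)%N.
Qed.

Lemma pfaffian_coef12 i j k m : tau i j k m = - tau j i k m.
Proof.
rewrite /tau -[in RHS]sym_coef_reflect /reflect_pair /=.
by rewrite dualR dualL.
Qed.

Lemma pfaffian_coefC i j k m : tau i j k m = tau k m i j.
Proof. exact: sym_coefC. Qed.

Lemma pfaffian_coef34 i j k m : tau i j k m = - tau i j m k.
Proof. by rewrite pfaffian_coefC pfaffian_coef12 pfaffian_coefC. Qed.

(* Invariance under the root vector of eps_j - eps_k, read at the index pairs (i, j), (j, m). *)
Lemma pfaffian_coef23_lt (i j k m : 'I_l) : (j < k)%N -> i != j -> m != j ->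
  tau i j k m = - tau i k j m.
Proof.
move=> jk /negPf ij /negPf mj.
have [_ hr _] := hw.
have := hr _ _ (@sogen_positive_root F l (lshift l j) (lshift l k) _ _) (@sogen_root_vector F l _ _).
have := ltn_ord k; rewrite !rho_checkL dualL eq_lrshift => kl /(_ _ isT).
have -> : (l.-1%:Z - k%:Z < l.-1%:Z - j%:Z) by lia.
move=> /(_ isT)/(sym_coef_raise (lshift l i, rshift l j) (lshift l j, rshift l m)) e.
have E1 x : entry (lie (sogen F (lshift l j) (lshift l k)) x) (lshift l i, rshift l j) =
    so_mx x (lshift l i) (rshift l k).
  rewrite entry_lie_sogen !dualL eq_lshift ij !eq_lrshift eq_rlshift eqxx !mul0r subrr.
  by rewrite mul1r !sub0r opprK.
have E2 x : entry (lie (sogen F (lshift l j) (lshift l k)) x) (lshift l j, rshift l m) =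
    so_mx x (lshift l k) (rshift l m).
  rewrite entry_lie_sogen !dualL eq_lrshift eq_rlshift eq_rshift mj eqxx !mul0r.
  by rewrite mul1r !subr0.
apply/eqP; rewrite -addr_eq0 -[X in _ == X]e /tau /sym_coef -big_split.
by apply/eqP/eq_bigr => p _; rewrite !E1 !E2 /entry /=; ring.
Qed.

Lemma pfaffian_coef23 i j k m : tau i j k m = - tau i k j m.
Proof.
(* If both coefficients vanish the claim is trivial; otherwise the four indices are distinct and the
   raising argument applies, to [j < k] or to [k < j]. *)
suff D : (tau i j k m != 0) || (tau i k j m != 0) -> tau i j k m = - tau i k j m.
  have [e|] := eqVneq (tau i j k m) 0; last by move=> h; apply: D; rewrite h.
  have [e'|] := eqVneq (tau i k j m) 0; last by move=> h; apply: D; rewrite h orbT.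
  by rewrite e e' oppr0.
move=> h; have c s : ((i == s) + (j == s) + (k == s) + (m == s) <= 1)%N.
  by case/orP: h => /(pfaffian_coef_distinct s);
    case: (i == s); case: (j == s); case: (k == s); case: (m == s).
have [jk|kj|/val_inj jk] := ltngtP j k.
- apply: pfaffian_coef23_lt => //; have := c j; rewrite eqxx.
    by case: (i == j); case: (k == j); case: (m == j).
  by case: (i == j); case: (k == j); case: (m == j).
- apply/eqP; rewrite -eqr_oppLR; apply/eqP/esym; apply: pfaffian_coef23_lt => //.
    by have := c k; rewrite eqxx; case: (i == k); case: (j == k); case: (m == k).
  by have := c k; rewrite eqxx; case: (i == k); case: (j == k); case: (m == k).
- by have := c k; rewrite jk eqxx; case: (i == k); case: (m == k).
Qed.

Lemma pfaffian_sym2 (W : lmodType F) (b : g -> g -> W) : symmetric_bilinear b ->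
  \sum_(p <- w) b p.1 p.2 = 8^-1 *: \sum_i \sum_j \sum_k \sum_m tau i j k m *:
    b (sogen F (lshift l i) (rshift l j)) (sogen F (lshift l k) (rshift l m)).
Proof.
move=> hb; rewrite (sym2_expand hb); congr (_ *: _).
have S (f : 'I_n * 'I_n -> W) : (forall q, f q != 0 -> low_left q.1 && low_right q.2) ->
    \sum_q f q = \sum_i \sum_j f (lshift l i, rshift l j).
  move=> fs.
  transitivity (\sum_i \sum_j f (i, j)); first by rewrite pair_bigA; apply: eq_bigr => -[].
  rewrite big_split_ord /= [X in _ + X]big1 ?addr0 => [|i _]; last first.
    rewrite big1 // => j _; have [//|/fs] := eqVneq (f (rshift l i, j)) 0.
    by case/andP => /low_leftP[k /eqP]; rewrite eq_rlshift.
  apply: eq_bigr => i _; rewrite big_split_ord /= [X in X + _]big1 ?add0r // => j _.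
  have [//|/fs] := eqVneq (f (lshift l i, lshift l j)) 0.
  by case/andP => _ /low_rightP[k /eqP]; rewrite eq_lrshift.
rewrite S => [|q f0]; last first.
  have [r] : exists r, T q r != 0; last by case/pfaffian_support/and4P => -> ->.
  apply: contrapT => nex; case/eqP: f0; rewrite big1 // => r _.
  have [->|T0] := eqVneq (T q r) 0; first by rewrite scale0r.
  by case: nex; exists r.
apply: eq_bigr => i _; apply: eq_bigr => j _; rewrite S // => r fr.
have : T (lshift l i, rshift l j) r != 0.
  by apply/eqP => T0; move: fr; rewrite T0 scale0r eqxx.
by case/pfaffian_support/and4P => _ _ -> ->.
Qed.

End PfaffianSquare.
End HighestWeightSquares.

(** * Zhu classes *)

Section ZhuOfCommutingProducts.
Variables (F : numFieldType) (g : lieAlgType F) (form : g -> g -> F) (k : F).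
Local Notation V := (Vaff form k).
Local Notation UA := (Uaff form k).
Variables (Y : V -> int -> V -> V) (theta : zhu_algebra Y -> Uenv g).
Hypothesis hY : affine_vertex_algebra Y.
Hypothesis htheta : zhu_identification theta.
Variable C : g -> Prop.
Hypothesis C_comm : forall x y, C x -> C y -> lie x y = 0.

Local Notation af x m := (aff form k x m : UA).

(** Relates the values of one noncommutative polynomial with letters in [C], taken at the modes
    [x(-1)] and at the elements [x] of U(g). *)
Inductive commuting_word : UA -> Uenv g -> Prop :=
| Word_one : commuting_word 1 1
| Word_comb a u u' z z' : commuting_word u z -> commuting_word u' z' ->
    commuting_word (a *: u + u') (a *: z + z')
| Word_letter x u z : C x -> commuting_word u z ->
    commuting_word (af x (-1) * u) (env_in x * z).

Lemma commuting_word0 : commuting_word 0 0.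
Proof.
have := Word_comb (-1) Word_one Word_one.
by rewrite !scaleN1r !addNr.
Qed.

Lemma commuting_word_scale a u z : commuting_word u z -> commuting_word (a *: u) (a *: z).
Proof. by move=> h; rewrite -[a *: u]addr0 -[a *: z]addr0; apply: Word_comb => //; apply: commuting_word0. Qed.

Lemma commuting_word_sum (I : finType) u z :
  (forall i : I, commuting_word (u i) (z i)) -> commuting_word (\sum_i u i) (\sum_i z i).
Proof.
move=> h; elim: (index_enum I) => [|i s IH]; first by rewrite !big_nil; apply: commuting_word0.
by rewrite !big_cons -[u i]scale1r -[z i]scale1r; apply: Word_comb.
Qed.

Lemma commuting_word_exp s t r :
  (forall u z, commuting_word u z -> commuting_word (s * u) (t * z)) ->
  commuting_word (s ^+ r) (t ^+ r).
Proof.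
move=> h; elim: r => [|r IH]; first by rewrite !expr0; apply: Word_one.
by rewrite !exprS; apply: h.
Qed.

Lemma aff0 m : af 0 m = 0.
Proof.
by have := aff_lin form k (-1) 0 0 m; rewrite scaler0 addr0 scaleN1r addNr.
Qed.

Lemma commuting_word_zero_mode u z x : commuting_word u z -> C x ->
  af x 0 * u = u * af x 0.
Proof.
move=> + Cx; elim=> [|a u1 u2 z1 z2 _ e1 _ e2|y u' z' Cy _ e].
- by rewrite mul1r mulr1.
- by rewrite mulrDr mulrDl e2 -presented_scalerAr e1 presented_scalerAl.
have := aff_lie form k x y 0 (-1).
rewrite C_comm // add0r aff0 scale0r addr0 => /eqP; rewrite subr_eq0 => /eqP e'.
by rewrite mulrA e' -mulrA e mulrA.
Qed.

(** For [x] of conformal weight 1 the Zhu product with [b] is the class of [x(-1) b + x(0) b]. The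
    zero mode commutes with every letter of the word and then kills the vacuum. *)
Lemma zhu_word u z : commuting_word u z ->
  theta (zhu_class Y (act u (vac form k))) = z.
Proof.
have th_lin : linear theta := zi_linear htheta.
elim=> [|a u1 u2 z1 z2 _ e1 _ e2|x u' z' Cx hu e].
- by rewrite /vac act_class mulr1 -(zi_one htheta).
- rewrite /vac !act_class !mulr1 in e1 e2 *.
  rewrite (_ : qclass _ _ = a *: qclass (vac_submod form k) u1 + qclass _ u2); last exact: linearP.
  rewrite (_ : zhu_class Y _ = a *: zhu_class Y (qclass (vac_submod form k) u1)
     + zhu_class Y (qclass (vac_submod form k) u2)); last exact: linearP.
  by rewrite th_lin e1 e2.
have cw : conformal_weight 1 (mode x (-1) (vac form k)) by apply: (@CW_mode _ _ _ _ 0 0); apply: CW_vac.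
have := zi_mul htheta (act u' (vac form k)) cw.
rewrite (zi_gen htheta) e => <-; congr (theta (zhu_class Y _)).
rewrite /zhu_mul !big_ord_recl big_ord0 addr0 /= !bin0 binn !scale1r.
rewrite !(va_gen hY) /mode /vac !act_class !mulr1.
have -> : (bump 0 0)%:Z - 1 = 0 by [].
have -> : qclass (vac_submod form k) (aff form k x 0 * u') = 0; last by rewrite addr0.
rewrite (commuting_word_zero_mode hu Cx) -[RHS](raddf0 (qclass (vac_submod form k))).
apply/qclassP; rewrite subr0; have [_ _ IM] := vac_ideal_left form k.
by apply: IM; apply/asboolP => I lI gI; apply: (gI x 0%N).
Qed.

End ZhuOfCommutingProducts.

Section SymmetrizedProducts.
Variables (F : numFieldType) (g : lieAlgType F) (form : g -> g -> F) (k : F).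

Definition aff_sym (x y : g) : Uaff form k := 2^-1 *:
  (aff form k x (-1) * aff form k y (-1) + aff form k y (-1) * aff form k x (-1)).

Definition env_sym (x y : g) : Uenv g := 2^-1 *: (env_in x * env_in y + env_in y * env_in x).

Definition symmetrization (w : sym2 g) : Uenv g := \sum_(p <- w) env_sym p.1 p.2.

Lemma aff_sym_bilinear : symmetric_bilinear aff_sym.
Proof.
split=> [a x y z|x y]; last by rewrite /aff_sym addrC.
rewrite /aff_sym aff_lin mulrDl mulrDr -presented_scalerAl -presented_scalerAr.
by rewrite addrACA [LHS]scalerDr; congr (_ + _); rewrite -scalerDr !scalerA mulrC.
Qed.

Lemma env_sym_bilinear : symmetric_bilinear env_sym.
Proof.
split=> [a x y z|x y]; last by rewrite /env_sym addrC.
rewrite /env_sym env_in_lin mulrDl mulrDr -scalerAl -scalerAr.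
by rewrite addrACA [LHS]scalerDr; congr (_ + _); rewrite -scalerDr !scalerA mulrC.
Qed.

Lemma half_double (M : lmodType F) (x : M) : 2^-1 *: (x + x) = x.
Proof. by rewrite -mulr2n -scaler_nat scalerA mulVf ?scale1r // pnatr_eq0. Qed.

Lemma aff_sym_comm x y : lie x y = 0 ->
  aff_sym x y = aff form k x (-1) * aff form k y (-1).
Proof.
move=> e; have := aff_lie form k x y (-1) (-1).
rewrite e aff0 scale0r addr0 => /eqP; rewrite subr_eq0 => /eqP e'.
by rewrite /aff_sym -e' half_double.
Qed.

Lemma env_sym_comm x y : lie x y = 0 -> env_sym x y = env_in x * env_in y.
Proof.
move=> e; have := env_in_lie x y; rewrite e linear0 => /esym/eqP.
by rewrite subr_eq0 => /eqP e'; rewrite /env_sym -e' half_double.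
Qed.

(** Equivariance of symmetrization from S^2(g) to U(g) for the adjoint actions. *)
Lemma symmetrization_ad e w : env_in e * symmetrization w =
  symmetrization w * env_in e + symmetrization (sym2_ad e w).
Proof.
have D x y : env_in e * (env_in x * env_in y) = env_in x * env_in y * env_in e
    + (env_in (lie e x) * env_in y + env_in x * env_in (lie e y)).
  by rewrite !env_in_lie mulrBl mulrBr !mulrA subrKA addrC subrK.
rewrite /symmetrization /sym2_ad big_cat !big_map /= mulr_sumr mulr_suml.
rewrite -!big_split; apply: eq_bigr => p _ /=.
rewrite /env_sym -scalerAr -scalerAl -!scalerDr; congr (_ *: _).
rewrite mulrDr !D mulrDl addrACA; congr (_ + _).
by rewrite (+%R).[AC (2*2) ((1*4)*(2*3))].
Qed.

End SymmetrizedProducts.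

(** * Powers of symmetrized highest-weight vectors on the Fock model *)

Section SymmetrizationPowers.
Variables (F : numFieldType) (l : nat) (hl : (2 < l)%N).
Local Notation n := (l + l)%N.
Local Notation g := (so F l).
Local Notation U := (Uenv g).
Local Notation o := (lshift l (idx0 hl)).
Local Notation act := (tensor_act (fock_a_map F hl) (fock_c_map F hl)).
Local Notation op := (env_op act).
Local Notation hv := (highest_vec F hl).

Lemma sogen_zero (i : 'I_n) : sogen F i (dual i) = 0.
Proof. by apply/val_inj; rewrite /= /sogen_mx dualK subrr. Qed.

Lemma borel_symmetrization_exp mu (w : sym2 g) i j r :
    is_highest_weight_sym2 mu w -> rho_check j <= rho_check i ->
  exists z, env_in (sogen F i j) * symmetrization w ^+ r = symmetrization w ^+ r * z.
Proof.
move=> [_ hr hc] ji.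
have Z : symmetrization (sym2_ad 0 w) = 0.
  by have := symmetrization_ad 0 w; rewrite linear0 mul0r mulr0 add0r.
have [c e] : exists c : F, env_in (sogen F i j) * symmetrization w =
    symmetrization w * (env_in (sogen F i j) + c%:A).
  rewrite symmetrization_ad; have [lt|ge] := ltP (rho_check j) (rho_check i).
    exists 0; rewrite scale0r addr0; have [->|jn] := eqVneq j (dual i).
      by rewrite sogen_zero Z linear0 mulr0 addr0.
    rewrite [symmetrization (sym2_ad _ _)](_ : _ = 0) ?addr0 //.
    have := hr _ _ (sogen_positive_root F lt jn) (@sogen_root_vector F l i j).
    by move/(_ _ _ (@env_sym_bilinear F g)); rewrite big_nil.
  have {ji ge} eh : rho_check i = rho_check j by apply/eqP; rewrite eq_le ge ji.
  have [<-|G0] := sogen_same_height F eh; last first.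
    by exists 0; rewrite G0 Z linear0 scale0r !addr0.
  exists (weight_at mu (sogen F i i)); rewrite mulrDr; congr (_ + _); rewrite /symmetrization.
  have := hc _ (sogen_cartan F i); move/(_ _ _ (@env_sym_bilinear F g)) => ->.
  rewrite big_map mulr_algr scaler_sumr; apply: eq_bigr => p _.
  have [bl _] := @env_sym_bilinear F g.
  have := bl (weight_at mu (sogen F i i)) p.1 0 p.2; rewrite addr0 => ->.
  by rewrite /env_sym linear0 mul0r mulr0 addr0 scaler0 addr0.
have {e} [d e] : exists d : F, env_in (sogen F i j) * symmetrization w ^+ r =
    symmetrization w ^+ r * (env_in (sogen F i j) + d%:A).
  elim: r => [|r [d IH]]; first by exists 0; rewrite !expr0 scale0r addr0 mulr1 mul1r.
  exists (c + d); rewrite exprS mulrA e -!mulrA; congr (_ * _).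
  rewrite mulrDl IH mulr_algl -[_ *: _ ^+ r]mulr_algr -mulrDr -addrA -scalerDl.
  by rewrite [d + c]addrC.
by exists (env_in (sogen F i j) + d%:A).
Qed.

Variables (L : lmodType U).
Hypothesis hL : is_simple_highest_weight_module (- simple_root F l 2) L.

Lemma symmetrization_exp_annihilates mu (w : sym2 g) r :
    is_highest_weight_sym2 mu w ->
    (forall z, top_coef hl (op (symmetrization w ^+ r * z) hv) = 0) ->
  annihilator L (symmetrization w ^+ r).
Proof.
move=> hw h0; have [Ls [v [v0 vr vw]]] := hL.
apply: (@annihilates_of_top_functional F l _ act _ _ _ hv (top_coef hl) (weight_at (- simple_root F l 2))
  _ _ _ _ _ L v Ls v0 _ vw) h0.
- exact: tensor_act_linl.
- exact: tensor_act_is_linear.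
- apply: tensor_act_lie; [exact: fock_aC|exact: fock_cC|exact: fock_ca].
- exact: highest_vec_raise.
- exact: highest_vec_weight.
- exact: top_coefP.
- exact: top_coef_lower.
- exact: top_coef_highest.
- move=> i j ji; have [->|jn] := eqVneq j (dual i).
    by rewrite sogen_zero linear0 scale0r.
  exact: vr (sogen_positive_root F ji jn) (@sogen_root_vector F l i j).
- by move=> i j ji; apply: borel_symmetrization_exp hw ji.
Qed.

Lemma op_sum (I : finType) (z : I -> U) p : op (\sum_i z i) p = \sum_i op (z i) p.
Proof.
have h1 := @tensor_act_linl F l _ (fock_a_map F hl) (fock_c_map F hl).
have h2 := @tensor_act_is_linear F l _ (fock_a_map F hl) (fock_c_map F hl).
have h3 := tensor_act_lie (@fock_aC F l hl) (@fock_cC F l hl) (@fock_ca F l hl).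
elim: (index_enum I) => [|i s IH]; first by rewrite !big_nil env_op0.
by rewrite !big_cons env_opD // IH.
Qed.

Local Notation A := (fock_a_map F hl).
Local Notation C := (fock_c_map F hl).

Lemma harmonic_op z p : harmonic A C p -> harmonic A C (op z p).
Proof.
rewrite /env_op; elim: (repr z) p => [x|a|s IHs t IHt|s IHs t IHt] p hp /=.
- exact: (harmonic_tensor_act (@fock_aC F l hl) (@fock_cC F l hl) (@fock_ca F l hl)).
- rewrite -[a *: p]addr0 -(addNr p) -scaleN1r.
  by apply: harmonic_comb => //; apply: harmonic_comb.
- by rewrite -[term_op _ s p]scale1r; apply: harmonic_comb; [apply: IHs|apply: IHt].
- by apply: IHs; apply: IHt.
Qed.

Definition kappa_map : {linear {mpoly F[n]} -> F^o} := @kappa F l hl.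

Lemma top_coef_quadric p : harmonic A C p ->
  top_coef hl (iter (l - 2) (quadric_op A C o) p) = 0.
Proof.
move=> hp.
have ka q : kappa_map (A (dual o) q) = 0.
  rewrite /= /fock_a dualL /special eqxx /= kappaXM //.
  by rewrite (inj_eq (@rshift_inj _ _)) -val_eqE.
have kc (i : 'I_l) q : kappa_map (C (lshift l i) q) = 0.
  by rewrite /= /fock_c /special !eq_lrshift /= linearN /= kappaXM ?oppr0 // eq_lrshift.
(* Level [k = 0], where [quadric_form] is [top_coef], with [m = l - 3]: the [l - 2] steps end at the
   vanishing factor. *)
have en : n = (2 * ((l - 3) + 0) + 6)%N by lia.
have := quadric_form_iter (@fock_aC F l hl) (@fock_cC F l hl) (@fock_ca F l hl)
  ka kc (kc _) en hp.
have -> : (l - 3).+1 = (l - 2)%N by lia.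
by rewrite /quadric_form scale0r subr0.
Qed.

End SymmetrizationPowers.

Section CommutingRaisingOperators.
Variables (F : numFieldType) (l : nat).
Local Notation n := (l + l)%N.

(** Products survive only for [u = dual v], and then both orders give the same multiple of the
    matrix unit at [(o, dual o)]. *)
Lemma lie_sogen_row (o u v : 'I_n) : u != o -> v != o ->
  lie (sogen F o u) (sogen F o v) = 0.
Proof.
move=> /negPf uo /negPf vo; apply/val_inj/matrixP => s t.
rewrite [LHS](entry_lie_sogen o u (sogen F o v) s t) [RHS]mxE !sogenE uo.
have -> : (dual o == o) = false by exact: dual_neq.
rewrite !(inj_eq (inv_inj (@dualK l))) ![o == v]eq_sym vo uo.
rewrite [o == dual o]eq_sym dual_neq (dual_eq u v) !andbF /=.
by case: (s == o); case: (u == dual v); case: (t == dual o) => /=; ring.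
Qed.

(** These strictly upper block-triangular matrices have zero products; they form the abelian
    nilradical attached to a maximal isotropic subspace. *)
Lemma lie_sogen_raise (i j k m : 'I_l) :
  lie (sogen F (lshift l i) (rshift l j)) (sogen F (lshift l k) (rshift l m)) = 0.
Proof.
apply/val_inj/matrixP => s t.
rewrite [LHS](entry_lie_sogen _ _ (sogen F (lshift l k) (rshift l m)) s t) [RHS]mxE !sogenE.
rewrite !dualL !dualR !eq_rlshift !eq_lrshift /= !andbF.
by rewrite !subrr !mulr0 !subrr.
Qed.

Lemma lie_sogen_quadric (o u : 'I_n) : lie (sogen F o u) (sogen F o (dual u)) = 0.
Proof.
have [->|uo] := eqVneq u o.
  by rewrite sogen_zero; apply/val_inj; rewrite /= mulmx0 mul0mx subrr.
have [->|uo'] := eqVneq u (dual o).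
  by rewrite sogen_zero; apply/val_inj; rewrite /= mulmx0 mul0mx subrr.
by apply: lie_sogen_row => //; rewrite dual_eq.
Qed.

End CommutingRaisingOperators.

Section Annihilation.
Variables (F : numFieldType) (l : nat).
Local Notation n := (l + l)%N.
Local Notation g := (so F l).
Local Notation U := (Uenv g).
Local Notation V := (Vminus1 F l).
Local Notation af x := (aff (@so_inner F l) (-1) x (-1)).
Variables (Y : V -> int -> V -> V) (theta : zhu_algebra Y -> U).
Hypothesis hY : affine_vertex_algebra Y.
Hypothesis htheta : zhu_identification theta.
Variable L : lmodType U.
Hypothesis hL : is_simple_highest_weight_module (- simple_root F l 2) L.

Lemma zhu_sigma_pow (C : g -> Prop) (w : sym2 g) r :
    (forall x y, C x -> C y -> lie x y = 0) ->
    (forall (u : Uaff (@so_inner F l) (-1)) z, commuting_word C u z ->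
      commuting_word C
        (sigma_op (@so_inner F l) (-1) w * u) (symmetrization w * z)) ->
  theta (zhu_class Y (sigma_pow (@so_inner F l) (-1) w r)) = symmetrization w ^+ r.
Proof.
by move=> hC hw; apply: (zhu_word hY htheta hC); apply: commuting_word_exp.
Qed.

Lemma quadric_annihilates (w : sym2 g) : (2 < l)%N ->
    is_highest_weight_sym2 (eps F l 1 *+ 2) w ->
  annihilator L (theta (zhu_class Y (sigma_pow (@so_inner F l) (-1) w (l - 2)))).
Proof.
move=> hl hw; have [c hc] := quadric_sym2 hl hw.
set o := lshift l (idx0 hl) in hc.
have eU : symmetrization w = c *: \sum_u env_in (sogen F o u) * env_in (sogen F o (dual u)).
  rewrite /symmetrization (hc _ _ (@env_sym_bilinear F g)); congr (_ *: _).
  by apply: eq_bigr => u _; rewrite env_sym_comm // lie_sogen_quadric.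
have eA : sigma_op (@so_inner F l) (-1) w =
    c *: \sum_u af (sogen F o u) * af (sogen F o (dual u)).
  rewrite /sigma_op (hc _ _ (@aff_sym_bilinear F g (@so_inner F l) (-1))).
  congr (_ *: _); apply: eq_bigr => u _; rewrite aff_sym_comm // lie_sogen_quadric.
  by [].
(* The letters omit [u = o], a Cartan element that does not commute with the others, and
   [u = dual o], where [sogen] is 0; both corresponding terms of the sum vanish. *)
rewrite (@zhu_sigma_pow (fun x => exists u, [/\ u != o, u != dual o & x = sogen F o u])).
- apply: (symmetrization_exp_annihilates (hl := hl) hL hw) => z.
  set act := tensor_act _ _.
  have h1 := @tensor_act_linl F l _ (fock_a_map F hl) (fock_c_map F hl).
  have h2 := @tensor_act_is_linear F l _ (fock_a_map F hl) (fock_c_map F hl).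
  have h3 := tensor_act_lie (@fock_aC F l hl) (@fock_cC F l hl) (@fock_ca F l hl).
  have Eop p : env_op act (symmetrization w) p =
      c *: quadric_op (fock_a_map F hl) (fock_c_map F hl) o p.
    rewrite eU env_opZ // op_sum /quadric_op; congr (_ *: _).
    by apply: eq_bigr => u _; rewrite env_opM // !env_op_in.
  have Epow r p : env_op act (symmetrization w ^+ r) p =
      c ^+ r *: iter r (quadric_op (fock_a_map F hl) (fock_c_map F hl) o) p.
    elim: r p => [|r IH] p; first by rewrite !expr0 env_op1 // scale1r.
    by rewrite exprS env_opM // IH env_opZr // Eop scalerA -exprSr.
  rewrite env_opM // Epow -[_ *: _]addr0 top_coefP top_coef_quadric ?mulr0 ?add0r.
    by rewrite /top_coef ffunE linear0.
  exact/harmonic_op/highest_vec_harmonic.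
- by move=> x y [u [uo _ ->]] [v [vo _ ->]]; apply: lie_sogen_row.
move=> x z hx; rewrite eU eA -presented_scalerAl -scalerAl.
apply: commuting_word_scale; rewrite !mulr_suml; apply: commuting_word_sum => u.
have [->|uo] := eqVneq u o.
  by rewrite sogen_zero linear0 aff0 !mulr0 !mul0r; apply: commuting_word0.
have [->|uo'] := eqVneq u (dual o).
  by rewrite sogen_zero linear0 aff0 !mul0r; apply: commuting_word0.
rewrite -!mulrA; apply: Word_letter; first by exists u.
apply: Word_letter => //; exists (dual u).
by rewrite dual_eq (inj_eq (inv_inj (@dualK l))).
Qed.

Lemma pfaffian_annihilates (w : sym2 g) : (4 <= l)%N ->
    is_highest_weight_sym2 (eps F l 1 + eps F l 2 + eps F l 3 + eps F l 4) w ->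
  annihilator L (theta (zhu_class Y (sigma_pow (@so_inner F l) (-1) w 2))).
Proof.
move=> hl4 hw; have hl : (2 < l)%N by apply: ltnW.
pose X (i j : 'I_l) := sogen F (lshift l i) (rshift l j).
pose tau := pfaffian_coef w.
have eU : symmetrization w = 8^-1 *: \sum_i \sum_j \sum_k \sum_m
    tau i j k m *: (env_in (X i j) * env_in (X k m)).
  rewrite /symmetrization (pfaffian_sym2 hl4 hw (@env_sym_bilinear F g)); congr (_ *: _).
  do 4!(apply: eq_bigr => ? _); rewrite env_sym_comm //; exact: lie_sogen_raise.
have eA : sigma_op (@so_inner F l) (-1) w = 8^-1 *: \sum_i \sum_j \sum_k \sum_m
    tau i j k m *: (af (X i j) * af (X k m)).
  rewrite /sigma_op (pfaffian_sym2 hl4 hw (@aff_sym_bilinear F g (@so_inner F l) (-1))).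
  congr (_ *: _); do 4!(apply: eq_bigr => ? _); rewrite aff_sym_comm //; exact: lie_sogen_raise.
rewrite (@zhu_sigma_pow (fun x => exists i j, x = X i j)).
- apply: (symmetrization_exp_annihilates (hl := hl) hL hw) => z.
  set act := tensor_act _ _.
  have h1 := @tensor_act_linl F l _ (fock_a_map F hl) (fock_c_map F hl).
  have h2 := @tensor_act_is_linear F l _ (fock_a_map F hl) (fock_c_map F hl).
  have h3 := tensor_act_lie (@fock_aC F l hl) (@fock_cC F l hl) (@fock_ca F l hl).
  have Eop p : env_op act (symmetrization w) p =
      8^-1 *: pfaffian_op (fock_a_map F hl) (fock_c_map F hl) tau p.
    rewrite eU env_opZ // /pfaffian_op; congr (_ *: _).
    rewrite op_sum; apply: eq_bigr => i _; rewrite op_sum; apply: eq_bigr => j _.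
    rewrite op_sum; apply: eq_bigr => k _; rewrite op_sum; apply: eq_bigr => m _.
    by rewrite env_opZ // env_opM // !env_op_in.
  rewrite expr2 -mulrA env_opM // env_opM // !Eop -Eop env_opZr // Eop.
  rewrite (pfaffian_op_sqr (@fock_aC F l hl) (@fock_ca F l hl) (pfaffian_coef12 w)
    (pfaffian_coef23 hl4 hw) (pfaffian_coef34 w)) !scaler0.
  by rewrite /top_coef ffunE linear0.
- by move=> x y [i [j ->]] [k [m ->]]; apply: lie_sogen_raise.
move=> x z hx; rewrite eU eA -presented_scalerAl -scalerAl.
apply: commuting_word_scale.
rewrite !mulr_suml; apply: commuting_word_sum => i.
rewrite !mulr_suml; apply: commuting_word_sum => j.
rewrite !mulr_suml; apply: commuting_word_sum => k.
rewrite !mulr_suml; apply: commuting_word_sum => m.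
rewrite -presented_scalerAl -scalerAl -!mulrA; apply: commuting_word_scale.
by apply: Word_letter; [exists i, j|apply: Word_letter; first by exists k, m].
Qed.

End Annihilation.

Lemma annihilator_two_sided (A : pzRingType) (M : lmodType A) :
  two_sided_ideal (@annihilator A M).
Proof.
split=> [v|x y hx hy v|a x b hx v]; first by rewrite scale0r.
- by rewrite scalerDl hx hy addr0.
- by rewrite -!scalerA hx scaler0.
Qed.

Theorem theorem4p13 (R : realType) (l : nat) (hl : (5 <= l)%N)
    (Y : Vminus1 R[i] l -> int -> Vminus1 R[i] l -> Vminus1 R[i] l)
    (hY : affine_vertex_algebra Y)
    (theta : zhu_algebra Y -> Uenv (so R[i] l))
    (htheta : zhu_identification theta)
    (wA wD : sym2 (so R[i] l))
    (hA : is_highest_weight_sym2 (eps R[i] l 1 *+ 2) wA)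
    (hD : is_highest_weight_sym2
            (eps R[i] l 1 + eps R[i] l 2 + eps R[i] l 3 + eps R[i] l 4) wD)
    (L : lmodType (Uenv (so R[i] l)))
    (hL : is_simple_highest_weight_module (- simple_root R[i] l 2) L) :
  forall u : Uenv (so R[i] l), I_cand theta wA wD u -> annihilator L u.
Proof.
(* Membership in the generated ideal is tested on the annihilator, leaving only the two
   generators. *)
move=> u; apply; first exact: annihilator_two_sided.
move=> x [->|->].
- by apply: (quadric_annihilates hY htheta hL _ hA); apply: leq_trans hl.
- by apply: (pfaffian_annihilates hY htheta hL _ hD); apply: leq_trans hl.
Qed.
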